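(* Let $H$ be a hyperbolically embedded subgroup of a group $\Gamma$, let $n\geq 2$ and suppose that $H^{n-1}(H)$ is finite-dimensional. If both $EH^n_b(\Gamma)$ and $EH^n_b(H)$ are endowed with the seminorm $\|\cdot\|_{\infty,0}$, then the inclusion $H\hookrightarrow\Gamma$ induces an undistorted surjection $$EH^n_b(\Gamma)\longrightarrow EH^n_b(H).$$
   Context: For a group $\Gamma$, $C^n(\Gamma)$ is the space of functions $\varphi:\Gamma^{n+1}\to\mathbb{R}$, with action $(g\cdot\varphi)(g_0,\dots,g_n)=\varphi(g^{-1}g_0,\dots,g^{-1}g_n)$, differential $\delta\varphi(g_0,\dots,g_{n+1})=\sum_{i}(-1)^i\varphi(g_0,\dots,\widehat{g_i},\dots,g_{n+1})$, and norm $\|\varphi\|_\infty=\sup|\varphi|\in[0,\infty]$. $C^n_b(\Gamma)$ is the subspace of bounded cochains, and a superscript $\Gamma$ denotes $\Gamma$-invariant elements. $H^*(\Gamma)$ and $H^*_b(\Gamma)$ are the cohomologies of $C^*(\Gamma)^\Gamma$ and $C^*_b(\Gamma)^\Gamma$. $EH^n_b(\Gamma)$ is the kernel of the comparison map $H^n_b(\Gamma)\to H^n(\Gamma)$. For $\alpha\in EH^n_b(\Gamma)$ and a finite subset $S\subseteq\Gamma$ set $$\|\alpha\|_S=\inf\{\|\delta\varphi\|_\infty \mid \varphi\in C^{n-1}(\Gamma)^\Gamma,\ [\delta\varphi]=\alpha \text{ in } H^n_b(\Gamma),\ \varphi|_{S^n}=0\},$$ and $\|\alpha\|_{\infty,0}=\sup\{\|\alpha\|_S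 \mid S\subseteq\Gamma \text{ finite}\}\in[0,+\infty]$ (so this seminorm may take the value $+\infty$). A map $f:V\to W$ between seminormed vector spaces is undistorted if there exists $k\ge 0$ such that for every $\alpha\in f(V)$ there exists $\beta\in V$ with $f(\beta)=\alpha$ and $\|\beta\|\le k\cdot\|\alpha\|$. Hyperbolically embedded is meant in the sense of Dahmani–Guirardel–Osin: there is a subset $Y\subseteq\Gamma$ such that $Y\cup H$ generates $\Gamma$, the Cayley graph $\mathrm{Cay}(\Gamma,Y\sqcup H)$ is Gromov hyperbolic, and for every $h\in H$ and $r\ge 0$ only finitely many $h'\in H$ can be joined to $h$ by a path of length at most $r$ in $\mathrm{Cay}(\Gamma,Y\sqcup H)$ that contains no edge of the subgraph $\mathrm{Cay}(H,H)$. *)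

(* Defs.v *)
From HB Require Import structures.
From mathcomp Require Import all_boot all_order all_algebra.
From mathcomp Require Import boolp classical_sets functions cardinality.
From mathcomp Require Import reals constructive_ereal ereal.

Set Implicit Arguments.
Unset Strict Implicit.
Unset Printing Implicit Defensive.
Import Order.TTheory GRing.Theory Num.Theory.

Local Open Scope ring_scope.
Local Open Scope quotient_scope.
Local Open Scope classical_set_scope.

Section QuotientModule.
Variables (R : pzRingType) (V : lmodType R) (I : submodClosed V).

(* Over a ring, closure under opposite follows from closure under scaling. *)
Definition zmod_of_submod : zmodClosed V :=
  HB.pack (GRing.SubmodClosed.sort I)
    (GRing.isZmodClosed.Build V _ (GRing.submod_closedB (submodClosedP I))).

Definition quot_mod : Type := Quotient.quot zmod_of_submod.
Local Notation Q := quot_mod.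
HB.instance Definition _ := GRing.Zmodule.on Q.
HB.instance Definition _ := EqQuotient.on Q.

Lemma quot_pi_eq v w : (\pi_Q v == \pi_Q w) = (v - w \in I).
Proof. exact/esym/(@Quotient.idealrBE _ zmod_of_submod). Qed.

Lemma quot_piD v w : \pi_Q (v + w) = \pi_Q v + \pi_Q w.
Proof. exact: (@Quotient.pi_add _ zmod_of_submod). Qed.

Definition quot_scale (c : R) : Q -> Q := lift_op1 Q ( *:%R c).

Lemma quot_scaleE c v : quot_scale c (\pi_Q v) = \pi_Q (c *: v).
Proof.
unlock quot_scale; apply/eqP; rewrite quot_pi_eq -scalerBr.
by apply: rpredZ; rewrite -quot_pi_eq reprK.
Qed.

Lemma quot_scaleA c d (a : Q) :
  quot_scale c (quot_scale d a) = quot_scale (c * d) a.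
Proof. by elim/quotW: a => v; rewrite !quot_scaleE scalerA. Qed.

Lemma quot_scale1 : left_id 1 quot_scale.
Proof. by elim/quotW=> v; rewrite quot_scaleE scale1r. Qed.

Lemma quot_scaleDr : right_distributive quot_scale +%R.
Proof.
move=> c; elim/quotW=> v; elim/quotW=> w.
by rewrite !quot_scaleE -!quot_piD quot_scaleE scalerDr.
Qed.

Lemma quot_scaleDl (a : Q) : {morph quot_scale^~ a : c d / c + d}.
Proof.
by move=> c d; elim/quotW: a => v; rewrite !quot_scaleE -quot_piD scalerDl.
Qed.

HB.instance Definition _ := GRing.Zmodule_isLmodule.Build R Q
  quot_scaleA quot_scale1 quot_scaleDr quot_scaleDl.

Lemma quot_piZ c v : \pi_Q (c *: v) = c *: \pi_Q v.
Proof. by rewrite [RHS]quot_scaleE. Qed.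

End QuotientModule.

Section QuotientMap.
Variables (R : pzRingType) (V W : lmodType R).
Variables (I : submodClosed V) (J : submodClosed W).

Definition quot_map (f : V -> W) (a : quot_mod I) : quot_mod J :=
  \pi_(quot_mod J) (f (repr a)).

Variable f : {linear V -> W}.
Hypothesis fIJ : forall v, v \in I -> f v \in J.

Lemma quot_mapE v :
  quot_map f (\pi_(quot_mod I) v) = \pi_(quot_mod J) (f v).
Proof.
apply/eqP; rewrite /quot_map quot_pi_eq -raddfB.
by apply: fIJ; rewrite -quot_pi_eq reprK.
Qed.

Lemma quot_map_linear : linear (quot_map f).
Proof.
move=> c; elim/quotW=> v; elim/quotW=> w; rewrite -quot_piZ -quot_piD !quot_mapE.
by rewrite linearP quot_piD quot_piZ.
Qed.

End QuotientMap.

Arguments quot_map {R V W} I J f a.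

(* A function of k arguments is a cochain of degree k - 1, so that C^n is
   [cochain R G n.+1] and the differential is total in k. *)
Definition cochain (R : realType) (G : Type) (k : nat) := ('I_k -> G) -> R^o.
HB.instance Definition _ R G k :=
  GRing.Lmodule.copy (cochain R G k) (('I_k -> G) -> R^o).

Section Cochain.
Variables (R : realType) (G : groupType).
Implicit Types (b : bool) (n k : nat).

Definition act k (g : G) (phi : cochain R G k) : cochain R G k :=
  fun x => phi (fun i => (g^-1 * x i)%g).

Definition invariant k (phi : cochain R G k) : Prop :=
  forall g, act g phi = phi.

(* [lift i] enumerates 'I_k.+1 with i omitted. *)
Definition delta k (phi : cochain R G k) : cochain R G k.+1 :=
  fun x => \sum_(i < k.+1) (-1) ^+ i * phi (fun j => x (lift i j)).

Definition supnorm k (phi : cochain R G k) : \bar R :=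
  ereal_sup [set `|phi x|%:E | x in [set: 'I_k -> G]].

Definition bounded k (phi : cochain R G k) : Prop :=
  exists M : R, forall x, `|phi x| <= M.

(* The flag b selects bounded (b = true) or arbitrary (b = false) cochains.
   The complex starts in degree 0: the only cochain of degree -1 is 0. *)
Definition in_complex b k (phi : cochain R G k) : Prop :=
  [/\ invariant phi, b -> bounded phi & k = 0%N -> phi = 0].

Definition is_cocycle b n : pred (cochain R G n.+1) :=
  fun phi => `[< in_complex b phi /\ delta phi = 0 >].

Lemma act_linear k g : linear (@act k g).
Proof. by move=> c phi psi; apply/funext. Qed.

Lemma delta_linear k : linear (@delta k).
Proof.
move=> c phi psi; apply/funext => x; rewrite /delta.
rewrite -[RHS]/(c * (\sum_(i < k.+1) _) + \sum_(i < k.+1) _).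
rewrite big_distrr -big_split /=; apply: eq_bigr => i _.
rewrite -[(c *: phi + psi) _]/(c * phi _ + psi _) mulrDr.
by rewrite mulrCA.
Qed.

HB.instance Definition _ k := GRing.isLinear.Build R _ _ _ _ (@delta_linear k).

Lemma in_complex0 b k : in_complex b (0 : cochain R G k).
Proof.
split=> [g|_|//]; first exact/funext.
by exists 0 => x; rewrite normr0.
Qed.

Lemma in_complexP b k c (phi psi : cochain R G k) :
  in_complex b phi -> in_complex b psi -> in_complex b (c *: phi + psi).
Proof.
move=> [iphi bphi phi0] [ipsi bpsi psi0]; split.
- by move=> g; rewrite act_linear iphi ipsi.
- move=> hb; have [M hM] := bphi hb; have [N hN] := bpsi hb.
  exists (`|c| * M + N) => x; apply: le_trans (ler_normD _ _) _.
  by apply: lerD => //; rewrite normrM ler_wpM2l.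
- by move=> k0; rewrite phi0 // psi0 // scaler0 addr0.
Qed.

Lemma is_cocycle_submod b n : submod_closed (@is_cocycle b n).
Proof.
split; first by apply/asboolP; split; [exact: in_complex0 | rewrite linear0].
move=> c phi psi /asboolP[Cphi dphi] /asboolP[Cpsi dpsi]; apply/asboolP.
by split; [exact: in_complexP | rewrite delta_linear dphi dpsi scaler0 addr0].
Qed.

HB.instance Definition _ b n :=
  GRing.isSubmodClosed.Build R _ (@is_cocycle b n) (@is_cocycle_submod b n).

Definition cocycle b n : Type := {phi | @is_cocycle b n phi}.
HB.instance Definition _ b n := SubChoice.on (cocycle b n).
HB.instance Definition _ b n := [SubChoice_isSubLmodule of cocycle b n by <:].

Definition is_coboundary b n : pred (cocycle b n) :=
  fun z => `[< exists2 phi : cochain R G n,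
                 in_complex b phi & delta phi = val z >].

Lemma is_coboundary_submod b n : submod_closed (@is_coboundary b n).
Proof.
split; first by apply/asboolP; exists 0; [exact: in_complex0 | rewrite !linear0].
move=> c z w /asboolP[phi Cphi dphi] /asboolP[psi Cpsi dpsi]; apply/asboolP.
by exists (c *: phi + psi); [exact: in_complexP | rewrite delta_linear dphi dpsi linearP].
Qed.

Definition coboundaries b n : submodClosed (cocycle b n) :=
  HB.pack (@is_coboundary b n)
    (GRing.isSubmodClosed.Build R _ _ (@is_coboundary_submod b n)).

Definition cohomology b n : lmodType R := quot_mod (coboundaries b n).

Definition class b n (z : cocycle b n) : cohomology b n :=
  \pi_(quot_mod (coboundaries b n)) z.

End Cochain.

Arguments cocycle : clear implicits.
Arguments cohomology : clear implicits.
Arguments coboundaries : clear implicits.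

Notation Hn R G n := (cohomology R G false n).
Notation Hb R G n := (cohomology R G true n).

Section Comparison.
Variables (R : realType) (G : groupType) (n : nat).

Lemma forget_bound_subproof (z : cocycle R G true n) :
  is_cocycle false (val z).
Proof. by case: z => phi /= /asboolP[[? _ ?] ?]; apply/asboolP. Qed.

Definition forget_bound (z : cocycle R G true n) : cocycle R G false n :=
  Sub (val z) (forget_bound_subproof z).

Lemma forget_bound_linear : linear forget_bound.
Proof. by move=> c z w; apply/val_inj. Qed.

HB.instance Definition _ :=
  GRing.isLinear.Build R _ _ _ _ forget_bound_linear.

Lemma forget_bound_coboundary z :
  z \in coboundaries R G true n ->
  forget_bound z \in coboundaries R G false n.
Proof.
move=> /asboolP[phi [? _ ?] ?]; apply/asboolP.
by exists phi.
Qed.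

Definition comparison : Hb R G n -> Hn R G n :=
  quot_map (coboundaries R G true n) (coboundaries R G false n) forget_bound.

Lemma comparison_linear : linear comparison.
Proof. exact: (quot_map_linear forget_bound_coboundary). Qed.

HB.instance Definition _ := GRing.isLinear.Build R _ _ _ _ comparison_linear.

Definition in_EHb : pred (Hb R G n) := fun a => comparison a == 0.

Lemma in_EHb_submod : submod_closed in_EHb.
Proof.
split; first by rewrite unfold_in /in_EHb linear0.
move=> c a b; rewrite !unfold_in /in_EHb => /eqP a0 /eqP b0.
by rewrite comparison_linear a0 b0 scaler0 addr0.
Qed.

HB.instance Definition _ :=
  GRing.isSubmodClosed.Build R _ in_EHb in_EHb_submod.

Definition EHb : Type := {a : Hb R G n | in_EHb a}.
HB.instance Definition _ := SubChoice.on EHb.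
HB.instance Definition _ := [SubChoice_isSubLmodule of EHb by <:].

End Comparison.

Arguments EHb : clear implicits.

Section Pullback.
Variables (R : realType) (G L : groupType) (f : UMagmaMorphism.type L G).
Variables (b : bool) (n : nat).

Definition pullback k (phi : cochain R G k) : cochain R L k :=
  fun x => phi (f \o x).

Lemma pullback_in_complex k (phi : cochain R G k) :
  in_complex b phi -> in_complex b (pullback phi).
Proof.
move=> [iphi bphi phi0]; split.
- move=> g; apply/funext => x; rewrite /act /pullback -[in RHS](iphi (f g)).
  by congr phi; apply/funext => i /=; rewrite gmulfM gmulfV.
- by move=> /bphi[M hM]; exists M => x; exact: hM.
- by move=> k0; rewrite phi0.
Qed.

Lemma delta_pullback k (phi : cochain R G k) :
  delta (pullback phi) = pullback (delta phi).
Proof. by []. Qed.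

Lemma pullback_cocycle_subproof (z : cocycle R G b n) :
  is_cocycle b (pullback (val z)).
Proof.
case: z => phi /= /asboolP[Cphi dphi]; apply/asboolP.
by split; [exact: pullback_in_complex | rewrite delta_pullback dphi].
Qed.

Definition pullback_cocycle (z : cocycle R G b n) : cocycle R L b n :=
  Sub (pullback (val z)) (pullback_cocycle_subproof z).

Lemma pullback_cocycle_linear : linear pullback_cocycle.
Proof. by move=> c z w; apply/val_inj. Qed.

HB.instance Definition _ :=
  GRing.isLinear.Build R _ _ _ _ pullback_cocycle_linear.

Lemma pullback_coboundary z :
  z \in coboundaries R G b n ->
  pullback_cocycle z \in coboundaries R L b n.
Proof.
move=> /asboolP[phi Cphi dphi]; apply/asboolP.
exists (pullback phi); first exact: pullback_in_complex.
by rewrite delta_pullback dphi.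
Qed.

Definition cohomology_map : cohomology R G b n -> cohomology R L b n :=
  quot_map (coboundaries R G b n) (coboundaries R L b n) pullback_cocycle.

Lemma cohomology_map_linear : linear cohomology_map.
Proof. exact: (quot_map_linear pullback_coboundary). Qed.

HB.instance Definition _ :=
  GRing.isLinear.Build R _ _ _ _ cohomology_map_linear.

End Pullback.

Section EHbMap.
Variables (R : realType) (G L : groupType) (f : UMagmaMorphism.type L G).
Variable n : nat.

Lemma comparison_cohomology_map (a : Hb R G n) :
  comparison (cohomology_map f a) = cohomology_map f (comparison a).
Proof.
elim/quotW: a => z; rewrite /comparison /cohomology_map.
rewrite (quot_mapE (@pullback_coboundary R G L f true n)).
rewrite (quot_mapE (@forget_bound_coboundary R L n)).
rewrite (quot_mapE (@forget_bound_coboundary R G n)).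
rewrite (quot_mapE (@pullback_coboundary R G L f false n)).
by congr (\pi_ _ _); exact/val_inj.
Qed.

Lemma EHb_map_subproof (a : EHb R G n) : in_EHb (cohomology_map f (val a)).
Proof.
by case: a => a /= /eqP a0; rewrite /in_EHb comparison_cohomology_map a0 linear0.
Qed.

Definition EHb_map (a : EHb R G n) : EHb R L n :=
  Sub (cohomology_map f (val a)) (EHb_map_subproof a).

Lemma EHb_map_linear : linear EHb_map.
Proof. by move=> c a b; apply/val_inj; exact: cohomology_map_linear. Qed.

HB.instance Definition _ := GRing.isLinear.Build R _ _ _ _ EHb_map_linear.

End EHbMap.

Arguments EHb_map R {G L} f n a.

Section Seminorm.
Variables (R : realType) (G : groupType) (n : nat).
Local Open Scope ereal_scope.

Definition normS (S : set G) (a : EHb R G n) : \bar R :=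
  ereal_inf [set supnorm (delta phi) | phi in
    [set phi : cochain R G n |
      [/\ in_complex false phi,
          (exists2 z : cocycle R G true n, val z = delta phi & class z = val a)
        & forall x : 'I_n -> G, (forall i, S (x i)) -> phi x = 0%R]]].

Definition norm_infty0 (a : EHb R G n) : \bar R :=
  ereal_sup [set normS S a | S in [set S : set G | finite_set S]].

End Seminorm.

Arguments norm_infty0 {R G n} a.

Definition undistorted (R : realType) (V W : Type)
    (normV : V -> \bar R) (normW : W -> \bar R) (f : V -> W) : Prop :=
  exists2 k : R, 0 <= k & forall a, range f a ->
    exists2 b, f b = a & (normV b <= k%:E * normW a)%E.

Definition finite_dimensional (R : realType) (V : lmodType R) : Prop :=
  exists (d : nat) (e : 'I_d -> V),
    forall v, exists c : 'I_d -> R, v = \sum_(i < d) c i *: e i.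

Section Graph.
Variables (T : Type) (e : rel T).

Definition within (r : nat) (x y : T) : Prop :=
  exists p : seq T, [/\ path e x p, last x p = y & (size p <= r)%N].

Definition geodesic (x : T) (p : seq T) : Prop :=
  path e x p /\
  forall q, path e x q -> last x q = last x p -> (size p <= size q)%N.

(* The Rips condition for a graph with symmetric adjacency relation e:
   geodesic triangles with sides x :: p, y :: q, z :: r, where
   y = last x p, z = last y q and x = last z r, are d-slim. *)
Definition hyperbolic_graph : Prop :=
  exists d : nat, forall (x y z : T) (p q r : seq T),
    geodesic x p -> last x p = y ->
    geodesic y q -> last y q = z ->
    geodesic z r -> last z r = x ->
    forall i, (i <= size p)%N ->
      (exists2 j, (j <= size q)%N & within d (nth x (x :: p) i) (nth y (y :: q) j))
   \/ (exists2 j, (j <= size r)%N & within d (nth x (x :: p) i) (nth z (z :: r) j)).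

End Graph.

Section HyperbolicallyEmbedded.
Variables (G : groupType) (P : {pred G}) (Y : set G).

Definition Y_edge : rel G := fun g h => `[< Y (g^-1 * h)%g \/ Y (h^-1 * g)%g >].
(* Symmetric when P is a subgroup. *)
Definition P_edge : rel G := fun g h => (g^-1 * h)%g \in P.

Definition cayley_adj : rel G := fun g h => Y_edge g h || P_edge g h.

(* Adjacency by an edge of Cay(G, Y |_| P) outside Cay(P, P): because the union
   of the generating sets is disjoint, two elements of P joined by an edge
   labelled in Y remain adjacent. *)
Definition relative_adj : rel G := fun g h =>
  Y_edge g h || P_edge g h && ~~ ((g \in P) && (h \in P)).

Definition generates : Prop := forall K : groupClosed G,
  (forall y, Y y -> y \in K) -> {subset P <= K} -> forall g, g \in K.

End HyperbolicallyEmbedded.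

Definition hyperbolically_embedded (G : groupType) (P : {pred G}) : Prop :=
  exists Y : set G,
    [/\ generates P Y,
        hyperbolic_graph (cayley_adj P Y) &
        forall h (r : nat), h \in P ->
          finite_set [set h' | h' \in P /\ within (relative_adj P Y) r h h']].

(* Main.v *)
From HB Require Import structures.
From mathcomp Require Import all_boot all_order all_algebra.
From mathcomp Require Import perm finmap zify ring lra.
From mathcomp Require Import boolp classical_sets functions cardinality fsbigop.
From mathcomp Require Import reals constructive_ereal ereal.
Require Import Defs.

Set Implicit Arguments.
Unset Strict Implicit.
Unset Printing Implicit Defensive.
Import Order.TTheory GRing.Theory Num.Theory.
Local Open Scope classical_set_scope.

(** Write [G] for the ambient group and [H] for the hyperbolically embedded
    subgroup.  A cochain on [H] lives on every coset of [H] by translation, and it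
    is extended to [G] by summing, over all cosets, its values on the projections
    of the vertices of a simplex.  The proof rests on three properties of this
    extension [Theta], collected in [extension_operator].

    The first is that [Theta] makes sense.  A geodesic of the Cayley graph that has
    no edge inside a coset projects to it with bounded diameter
    ([bounded_projection]).  Hence, for a given simplex, all but finitely many
    cosets see a small simplex, and there are only finitely many small simplices up
    to translation.  So [Theta] is defined on cochains that vanish on small
    simplices; it commutes with the differential ([Theta_delta]) and restricts to
    the given cochain on [H] ([Theta_inside]).

    The second is that [Theta] is a bounded operator on alternating cochains of at
    least three variables ([Theta_bounded]).  For this, nearest-point projections
    are modified by a bounded amount so that they become equal as soon as another
    coset separates both points from the coset of projection ([snap], [snap_close]).
    A coset contributes to [Theta] at a simplex only if all vertices of the simplex
    have different modified projections, and the number of such cosets is bounded in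
    terms of the dimension ([snap_branch]).  Applied to [delta phi], this shows that
    the extension of a primitive of a class of [H] is a primitive of a class of [G],
    which gives surjectivity ([res_surjective]) and the comparison of norms.

    The third concerns the choice of the class on [G].  The seminorm is a supremum
    over finite sets [S] of infima over primitives vanishing on [S], and these
    primitives depend on [S]: two of them differ by a cocycle and a bounded cochain.
    A bounded difference is harmless, since [Theta] maps it to a bounded cochain;
    but the extension of a cocycle that does not vanish on small simplices may
    represent a nonzero class.  Finite-dimensionality of the cohomology one degree
    below gives a single primitive to which only bounded corrections are needed, for
    all [S] at once ([uniform_primitive], from the compactness argument
    [select_combination]).  In degree two [Theta] does not preserve boundedness, but
    there a class of finite norm is zero ([bounded_one_cochain]). *)

(** * Walks and distances in graphs *)

Section Walks.
Variables (T : Type) (e : rel T).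
Implicit Types (x y z : T) (s : seq T) (r i j : nat).

Lemma within_refl r x : within e r x x.
Proof. by exists [::]. Qed.

Lemma within1 x y : e x y -> within e 1 x y.
Proof. by move=> exy; exists [:: y]; rewrite /= exy. Qed.

Lemma within_le r r' x y : (r <= r')%N -> within e r x y -> within e r' x y.
Proof. by move=> rr' [s [es ls ss]]; exists s; split=> //; apply: leq_trans rr'. Qed.

Lemma within_trans r r' x y z :
  within e r x y -> within e r' y z -> within e (r + r') x z.
Proof.
move=> [s [es ls ss]] [t [et lt st]]; exists (s ++ t).
by rewrite cat_path last_cat size_cat es ls et lt leq_add.
Qed.

Lemma within_sym r x y : symmetric e -> within e r x y -> within e r y x.
Proof.
move=> esym [s [es ls ss]]; exists (rev (belast x s)).
rewrite -ls size_rev size_belast; split=> //.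
  by rewrite rev_path (@eq_path _ _ e).
by case: s {es ls ss} => //= a s; rewrite rev_cons last_rcons.
Qed.

Lemma within_nth x s i j : path e x s -> (i <= j)%N -> (j <= size s)%N ->
  within e (j - i) (nth x (x :: s) i) (nth x (x :: s) j).
Proof.
elim: s x i j => [|a s IH] x [|i] [|j] //=; rewrite ?ltnS => es ij js //.
- exact: within_refl.
- exact: within_refl.
- case/andP: es => ea es; rewrite subn0 -add1n.
  apply: within_trans (within1 ea) _.
  by have := IH a 0 j es isT js; rewrite subn0 /= (set_nth_default x).
- case/andP: es => ea es; rewrite subSS -!(set_nth_default x a) /= ?ltnS //; first exact: IH.
  exact: leq_trans js.
Qed.

Lemma nth_cons_size x s : nth x (x :: s) (size s) = last x s.
Proof. by rewrite -[last x s](@nth_last _ x (x :: s)). Qed.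

Lemma within_homo (T' : Type) (e' : rel T') (f : T -> T') r x y :
  (forall u v, e u v -> e' (f u) (f v)) -> within e r x y -> within e' r (f x) (f y).
Proof.
move=> fe [s [es ls ss]]; exists (map f s).
rewrite path_map last_map ls size_map; split=> //.
exact: sub_path es.
Qed.

End Walks.

Section Distance.
Variables (T : Type) (e : rel T).
Hypotheses (esym : symmetric e) (econ : forall x y, exists r, within e r x y).
Implicit Types (x y z : T) (s : seq T) (r i j : nat).

Definition dist x y : nat :=
  ex_minn (P := fun r => `[< within e r x y >])
    (let: ex_intro r rP := econ x y in ex_intro _ r (asboolT rP)).

Lemma within_dist x y r : within e r x y <-> (dist x y <= r)%N.
Proof.
rewrite /dist; case: ex_minnP => m mP mmin; have {}mP := asboolW mP; split.
  by move=> xy; apply: mmin; apply/asboolP.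
by move=> mr; apply: within_le mr mP.
Qed.

Lemma distxx x : dist x x = 0.
Proof. by apply/eqP; rewrite -leqn0; apply/within_dist/within_refl. Qed.

Lemma dist_sym x y : dist x y = dist y x.
Proof.
by apply/eqP; rewrite eqn_leq; apply/andP; split; apply/within_dist/within_sym;
  rewrite // within_dist.
Qed.

Lemma dist_triangle y x z : (dist x z <= dist x y + dist y z)%N.
Proof. by apply/within_dist/(@within_trans _ _ _ _ _ y); apply/within_dist. Qed.

Lemma dist0 x y : dist x y = 0 -> x = y.
Proof.
move=> d0; have /within_dist[s [_ <-]] : (dist x y <= 0)%N by rewrite d0.
by case: s.
Qed.

Lemma geodesicP x s : geodesic e x s <-> path e x s /\ size s = dist x (last x s).
Proof.
split=> [[es smin]|[es sE]]; split=> //.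
  apply/eqP; rewrite eqn_leq; apply/andP; split; last first.
    by apply/within_dist; exists s.
  have /within_dist[q [eq lq sq]] := leqnn (dist x (last x s)).
  by apply: leq_trans sq; exact: smin.
by move=> q eq lq; rewrite sE; apply/within_dist; exists q.
Qed.

Lemma geodesic_ex x y : exists s, geodesic e x s /\ last x s = y.
Proof.
have /within_dist[s [es ls ss]] := leqnn (dist x y).
exists s; split=> //; apply/geodesicP; split=> //; rewrite ls.
by apply/eqP; rewrite eqn_leq ss; apply/within_dist; exists s.
Qed.

Lemma geodesic_size x s : geodesic e x s -> size s = dist x (last x s).
Proof. by move=> /geodesicP[]. Qed.

Lemma dist_nth x s i j : geodesic e x s -> (i <= j)%N -> (j <= size s)%N ->
  dist (nth x (x :: s) i) (nth x (x :: s) j) = (j - i)%N.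
Proof.
move=> /geodesicP[es sE] ij js.
have h a b : (a <= b)%N -> (b <= size s)%N ->
    (dist (nth x (x :: s) a) (nth x (x :: s) b) <= b - a)%N.
  by move=> ab bs; apply/within_dist/within_nth.
have := dist_triangle (nth x (x :: s) i) x (last x s).
have := dist_triangle (nth x (x :: s) j) (nth x (x :: s) i) (last x s).
have := h 0 i (leq0n _) (leq_trans ij js); have := h _ _ ij js.
have := h _ _ js (leqnn _); rewrite -sE -nth_cons_size /=.
lia.
Qed.

Lemma geodesic_split x s i : geodesic e x s -> (i <= size s)%N ->
  dist x (nth x (x :: s) i) = i /\ dist (nth x (x :: s) i) (last x s) = (size s - i)%N.
Proof.
move=> gs si; split; first by rewrite (dist_nth (i := 0)) // subn0.
by rewrite -nth_cons_size (dist_nth gs).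
Qed.

End Distance.

(** * Cosets in the Cayley graph *)

Section Cosets.
Variables (G : groupType) (P : groupClosed G) (Y : set G).
Implicit Types (g h u v x y p q : G) (B : set G) (r i j : nat) (s : seq G).

Definition coset g : set G := [set p | (g^-1 * p)%g \in P].

Lemma mem_coset g : coset g g.
Proof. by rewrite /coset/= mulVg gpred1. Qed.

Lemma coset_sym g p : coset g p -> coset p g.
Proof. by rewrite /coset /= -gpredV invgM invgK. Qed.

Lemma coset_trans p g q : coset g p -> coset p q -> coset g q.
Proof. by move=> gp /(gpredM _ _ gp); rewrite mulgA mulgK. Qed.

Lemma coset_eq g p : coset g p -> coset p = coset g.
Proof.
move=> gp; apply/funext => q; apply/propext; split; first exact: coset_trans.
exact/coset_trans/coset_sym.
Qed.

Lemma coset_eqP g h : coset g = coset h <-> coset g h.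
Proof. by split=> [->|/coset_eq //]; exact: mem_coset. Qed.

Lemma cosetM g u v : coset (g * u)%g (g * v)%g = coset u v.
Proof. by rewrite /coset /= invgM -mulgA mulKg. Qed.

Local Notation e := (cayley_adj P Y).

Lemma cayley_sym : symmetric e.
Proof.
move=> u v; rewrite /cayley_adj /Y_edge /P_edge -[in RHS]gpredV invgM invgK.
by congr (_ || _); apply: asbool_equiv_eq; split=> -[]; [right|left|right|left].
Qed.

Lemma cayleyM g u v : e (g * u)%g (g * v)%g = e u v.
Proof.
by rewrite /cayley_adj /Y_edge /P_edge !invgM -!(mulgA _ _ (g * _)%g) !mulKg.
Qed.

Lemma cayley_coset g p q : coset g p -> coset g q -> e p q.
Proof. by move=> /coset_sym gp /(coset_trans gp) pq; apply/orP; right. Qed.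

(** For a coset [B], path lengths in this graph measure how far apart two points of
    [B] are when the edges inside [B] are forbidden. *)
Definition radj B : rel G := fun u v =>
  Y_edge Y u v || P_edge P u v && ~~ (`[< B u >] && `[< B v >]).

Lemma radj_cayley B u v : radj B u v -> e u v.
Proof. by case/orP=> [Yuv|/andP[Puv _]]; apply/orP; [left|right]. Qed.

Lemma cayley_radj B u v : e u v -> ~ (B u /\ B v) -> radj B u v.
Proof.
case/orP=> [Yuv|Puv] nB; apply/orP; [by left|right].
by apply/andP; split=> //; apply/negP => /andP[/asboolP Bu /asboolP Bv]; apply: nB.
Qed.

Lemma radj_sym B : symmetric (radj B).
Proof.
move=> u v; rewrite /radj /Y_edge /P_edge andbC -[in RHS]gpredV invgM invgK.
rewrite [in RHS]andbC [in RHS](andbC `[< B v >]).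
by congr (_ || _); apply: asbool_equiv_eq; split=> -[]; [right|left|right|left].
Qed.

Lemma radjM g h u v : radj (coset (h * g)) (h * u)%g (h * v)%g = radj (coset g) u v.
Proof.
rewrite /radj !cosetM /Y_edge /P_edge.
by rewrite !invgM -!(mulgA _ _ (h * _)%g) !mulKg.
Qed.

Lemma radj_relative u v : radj (coset 1) u v = relative_adj P Y u v.
Proof. by rewrite /radj /relative_adj /coset /= invg1 !mul1g !asboolb. Qed.

Lemma withinM r g u v : within e r u v -> within e r (g * u)%g (g * v)%g.
Proof. by apply: within_homo => {}u {}v; rewrite cayleyM. Qed.

Lemma cayley_connected : generates P Y -> forall x y, exists r, within e r x y.
Proof.
pose K : {pred G} := fun g => `[< exists r, within e r 1%g g >].
have K1 : 1%g \in K by apply/asboolP; exists 0; exact: within_refl.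
have KM : {in K &, forall u v, (u * v)%g \in K}.
  move=> u v /asboolP[r ru] /asboolP[r' rv]; apply/asboolP; exists (r + r')%N.
  by apply: within_trans ru _; rewrite -[u in within _ _ u]mulg1; apply: withinM.
have KV : {in K, forall u, u^-1%g \in K}.
  move=> u /asboolP[r ru]; apply/asboolP; exists r; apply: within_sym.
    exact: cayley_sym.
  by have := withinM u^-1%g ru; rewrite mulg1 mulVg.
pose K' : groupClosed G := HB.pack K (isMulClosed.Build G K KM)
  (isMul1Closed.Build G K K1) (isInvClosed.Build G K KV).
move=> gen x y.
have [|p Pp|r] // := asboolW (gen K' _ _ (x^-1 * y)%g : `[< _ >]).
- move=> z Yz; apply/asboolP; exists 1; apply: within1.
  by apply/orP; left; apply/asboolP; left; rewrite invg1 mul1g.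
- apply/asboolP; exists 1; apply: within1.
  by apply/orP; right; rewrite /P_edge invg1 mul1g.
by move=> /(withinM x); rewrite mulg1 mulVKg; exists r.
Qed.

End Cosets.

(** * Snapping projections *)

Section Snapping.
Variables (T : Type) (coset : T -> set T) (close : set T -> nat -> T -> T -> Prop).
Variable c : nat.
Implicit Types (a b x y z u v w : T) (B : set T) (r i j n : nat).

Hypothesis mem_coset : forall a, coset a a.
Hypothesis coset_eq : forall a b, coset a b -> coset b = coset a.
Hypothesis close_le : forall B r r' x y,
  (r <= r')%N -> close B r x y -> close B r' x y.
Hypothesis close_sym : forall a r x y, close (coset a) r x y -> close (coset a) r y x.
Hypothesis close_trans : forall a r r' x y z,
  close (coset a) r x y -> close (coset a) r' y z -> close (coset a) (r + r') x z.
Hypothesis close_refl : forall a x, close (coset a) c x x.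
Hypothesis close_coset : forall a b b',
  coset b = coset b' -> coset a <> coset b -> close (coset a) c b b'.
Hypothesis behrstock : forall a b x,
  coset a <> coset b -> close (coset a) c x b \/ close (coset b) c x a.

(** In what follows [close (coset b) r x y] says that the projections of [x] and [y]
    to the coset of [b] are at distance at most [r], so [behind B a x] says that the
    coset of [a] separates [x] from [B].  The margin [4 * c] is the one that survives
    the two losses of [c] in [nested]. *)
Definition behind B a x := coset a <> B /\ forall b, B b -> ~ close (coset a) (4 * c) x b.

(** The equivalence relation generated by being behind a common coset.  Passing to
    the generated relation makes projections agree exactly, whereas the separating
    cosets of two points only agree up to an error. *)
Definition snap B x y := exists n (u a : nat -> T), [/\ u 0 = x, u n = y &
  forall i, (i < n)%N -> behind B (a i) (u i) /\ behind B (a i) (u i.+1)].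

Lemma snap_refl B x : snap B x x.
Proof. by exists 0, (fun=> x), (fun=> x). Qed.

Lemma snap_link B a x y : behind B a x -> behind B a y -> snap B x y.
Proof.
move=> ax ay; exists 1, (fun i => if i is 0 then x else y), (fun=> a).
by split=> // -[].
Qed.

Lemma snap_sym B x y : snap B x y -> snap B y x.
Proof.
move=> [n [u [a [u0 un link]]]].
exists n, (fun i => u (n - i)), (fun i => a (n - i.+1)).
rewrite subn0 subnn; split=> // i ilt.
have [|h1 h2] := link (n - i.+1)%N; first by lia.
by split=> //; rewrite -[(n - i)%N](_ : (n - i.+1).+1 = _) //; lia.
Qed.

Lemma snap_trans B x y z : snap B x y -> snap B y z -> snap B x z.
Proof.
move=> [n [u [a [u0 un link]]]] [m [v [b [v0 vm link']]]].
exists (n + m)%N, (fun i => if (i <= n)%N then u i else v (i - n)%N),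
  (fun i => if (i < n)%N then a i else b (i - n)%N); split=> //.
  have [m0|m_gt0] := posnP m; last by rewrite leqNgt -addn1 leq_add2l m_gt0 /= addKn.
  by move: vm; rewrite m0 v0 addn0 leqnn un.
move=> i ilt; have [iltn|nlei] := ltnP i n.
  by rewrite (ltnW iltn); apply: link.
have [|h1 h2] := link' (i - n)%N; first by lia.
rewrite subSn //; split=> //.
move: nlei; rewrite leq_eqVlt => /predU1P[nE|nlt]; last by rewrite leqNgt nlt.
by move: h1; rewrite -nE leqnn subnn v0 un.
Qed.

Lemma snap_inside B x y : B x -> snap B x y -> y = x.
Proof.
move=> Bx [[|n] [u [a [ux <- link]]]]; first by rewrite ux.
have [[_ /(_ _ Bx)]] := link 0 isT; rewrite ux; case.
by apply: (@close_le _ c); [lia | exact: close_refl].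
Qed.

(** Everything behind [a'] projects to the coset of [a] close to where [a'] does.
    The point [v], which is behind [a] by the larger margin, shows that this is far
    from the projection of [b]; it is what keeps the margin from shrinking when the
    lemma is applied along a chain. *)
Lemma nested a a' b z v w : coset a <> coset a' -> coset a' <> coset b ->
  close (coset a) c z a' -> ~ close (coset a) (2 * c) z b ->
  ~ close (coset a) (4 * c) v b -> ~ close (coset a') (2 * c) v b ->
  ~ close (coset a') (2 * c) w b -> ~ close (coset a) (2 * c) w b.
Proof.
move=> aa' a'b za' zb vb v'b w'b.
have near t : ~ close (coset a') (2 * c) t b -> close (coset a) c t a'.
  move=> tb; have [//|ta] := behrstock t aa'; case: tb.
  have [ba'|ba] := behrstock b aa'.
    case: zb; rewrite mul2n -addnn; apply: close_trans za' _; exact: close_sym.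
  rewrite mul2n -addnn; apply: close_trans ta _; exact: close_sym.
move=> wb; apply: vb; rewrite (_ : 4 * c = c + (c + 2 * c))%N; last by lia.
apply: close_trans (near _ v'b) _; apply: close_trans wb.
exact/close_sym/near.
Qed.

(** Drop the first link, and separately drop everything from the coset [l1] found
    for the rest on: the two shorter chains overlap in the points at which both
    cosets found are anchored by the larger margin, so [nested] applies without
    loss and the margin is the same for chains of any length. *)
Lemma chain_behind b n (u a : nat -> T) :
  (forall i, (i < n)%N -> behind (coset b) (a i) (u i) /\ behind (coset b) (a i) (u i.+1)) ->
  forall m i j, (j - i <= m)%N -> (i < j)%N -> (j <= n)%N ->
  exists2 l, (i <= l < j)%N &
    forall t, (i <= t <= j)%N -> ~ close (coset (a l)) (2 * c) (u t) b.
Proof.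
move=> link; have link1 i : (i < n)%N ->
    [/\ coset (a i) <> coset b, ~ close (coset (a i)) (4 * c) (u i) b &
        ~ close (coset (a i)) (4 * c) (u i.+1) b].
  by move=> /link[[ab /(_ _ (mem_coset b)) h1] [_ /(_ _ (mem_coset b)) h2]].
have le24 a' x y : ~ close (coset a') (4 * c) x y -> ~ close (coset a') (2 * c) x y.
  by move=> n4 h2; apply: n4; apply: close_le h2; lia.
elim=> [|m IH] i j ijm ij jn; first by lia.
move: ij; rewrite leq_eqVlt => /predU1P[jE|ij].
  exists i; first by lia.
  have [_ h1 h2] := link1 i ltac:(lia).
  move=> t; rewrite -jE => /andP[it]; rewrite leq_eqVlt ltnS.
  case/orP=> [/eqP ->|ti]; first exact: le24.
  by rewrite (_ : t = i); [exact: le24 | lia].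
have [l1 l1b on1] := IH i.+1 j ltac:(lia) ij jn.
have [l2 l2b on2] := IH i l1 ltac:(lia) ltac:(lia) ltac:(lia).
have [a1b v1 _] := link1 l1 ltac:(lia).
have [a2b _ v2] := link1 l2 ltac:(lia).
have v1' := on2 l1 ltac:(lia); have v2' := on1 l2.+1 ltac:(lia).
have [E|N] := pselect (coset (a l1) = coset (a l2)).
  exists l1; first by lia.
  move=> t tb; have [tl|lt] := leqP t l1; first by rewrite E; apply: on2; lia.
  by apply: on1; lia.
have [z12|z21] := behrstock (u l1) N.
  exists l1; first by lia.
  move=> t tb; have [tl|lt] := leqP t l1; last by apply: on1; lia.
  by apply: (nested N a2b z12 (le24 _ _ _ v1) v1 v1'); apply: on2; lia.
exists l2; first by lia.
move=> t tb; have [->|it] := eqVneq t i; first by apply: on2; lia.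
have {}N : coset (a l2) <> coset (a l1) by move/esym.
by apply: (nested N a1b z21 v1' v2 v2'); apply: on1; lia.
Qed.

(** A whole chain of snapped points is separated from the coset by a single other
    coset, and everything behind that coset projects close to it. *)
Lemma snap_close b x y : snap (coset b) x y -> close (coset b) (2 * c) x y.
Proof.
move=> [[|n] [u [a [<- <- link]]]].
  by apply: (@close_le _ c); [lia | exact: close_refl].
have [l /andP[_ ln] all] := chain_behind link (leqnn (n.+1 - 0)) isT (leqnn _).
have near t : (t <= n.+1)%N -> close (coset b) c (u t) (a l).
  move=> tn; have [[ab _] _] := link l ln; have [h|//] := behrstock (u t) ab.
  by case: (all t tn); apply: close_le h; lia.
rewrite mul2n -addnn; apply: close_trans (near _ (leq0n _)) _.
exact/close_sym/near.
Qed.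

(** The two cosets are met in some order on the way from [x] to [y]; the later
    one separates both [y] and [z] from the earlier one. *)
Lemma branch_unique b b' x y z : coset b <> coset b' ->
  ~ close (coset b) (12 * c) x y -> ~ close (coset b') (12 * c) x y ->
  ~ close (coset b) (6 * c) x z -> ~ close (coset b') (6 * c) x z ->
  snap (coset b) y z \/ snap (coset b') y z.
Proof.
have sep b1 b2 w r : (6 * c <= r)%N -> coset b1 <> coset b2 -> close (coset b2) c x b1 ->
    ~ close (coset b2) r x w -> behind (coset b1) b2 w.
  move=> rc N x1 xw; split; first by move/esym.
  move=> b3 b13 w3; apply: xw; apply: (@close_le _ (c + (c + 4 * c))); first by lia.
  apply: close_trans x1 _; apply: close_trans (close_sym w3).
  by apply: close_coset; [rewrite (coset_eq b13) | move/esym].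
move=> N xy x'y xz x'z; have N' : coset b' <> coset b by move/esym.
have [h|h] := behrstock x N'; [left|right].
  by apply: (@snap_link _ b'); [apply: sep x'y|apply: sep x'z] => //; lia.
by apply: (@snap_link _ b); [apply: sep xy|apply: sep xz] => //; lia.
Qed.

End Snapping.

(** * Nearest-point projections to cosets *)

Section Projections.
Variables (G : groupType) (P : groupClosed G) (Y : set G).
Implicit Types (g h u v x y p q : G) (B : set G) (r i j : nat) (s : seq G).
Hypothesis Ygen : generates P Y.

Local Notation e := (cayley_adj P Y).
Local Notation coset := (coset P).
Local Notation radj := (radj P Y).

Definition gdist : G -> G -> nat := dist (cayley_connected Ygen).

Lemma within_gdist x y r : within e r x y <-> (gdist x y <= r)%N.
Proof. exact: within_dist. Qed.

Lemma gdist_triangle y x z : (gdist x z <= gdist x y + gdist y z)%N.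
Proof. exact: dist_triangle. Qed.

Lemma gdist_size x s : geodesic e x s -> size s = gdist x (last x s).
Proof. exact: geodesic_size. Qed.

Lemma gdist_split x s i : geodesic e x s -> (i <= size s)%N ->
  gdist x (nth x (x :: s) i) = i /\ gdist (nth x (x :: s) i) (last x s) = (size s - i)%N.
Proof. exact: geodesic_split. Qed.

Lemma gdist_nth x s i j : geodesic e x s -> (i <= j)%N -> (j <= size s)%N ->
  gdist (nth x (x :: s) i) (nth x (x :: s) j) = (j - i)%N.
Proof. exact: dist_nth. Qed.

Lemma gdistC u v : gdist u v = gdist v u.
Proof. exact: (dist_sym (cayley_sym P Y)). Qed.

Lemma gdistM g u v : gdist (g * u)%g (g * v)%g = gdist u v.
Proof.
apply/eqP; rewrite eqn_leq; apply/andP; split; apply/within_gdist.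
  by apply: withinM; apply/within_gdist.
have /within_gdist/(withinM g^-1%g) := leqnn (gdist (g * u)%g (g * v)%g).
by rewrite !mulKg.
Qed.

Lemma gdist_coset g p q : coset g p -> coset g q -> (gdist p q <= 1)%N.
Proof. by move=> gp gq; apply/within_gdist/within1/(cayley_coset Y gp). Qed.

Definition nearest B x : set G := [set p | B p /\ forall q, B q -> (gdist x p <= gdist x q)%N].

Lemma nearest_ex g x : exists p, nearest (coset g) x p.
Proof.
have ex : exists n, `[< exists2 p, coset g p & gdist x p = n >].
  by exists (gdist x g); apply/asboolP; exists g => //; exact: mem_coset.
case: (ex_minnP ex) => n; move/(@asboolW _) => -[p gp <-] nmin.
by exists p; split=> // q gq; apply: nmin; apply/asboolP; exists q.
Qed.

Lemma nearest_mem B x p : nearest B x p -> B p. Proof. by case. Qed.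

Lemma nearest_self B x p : B x -> nearest B x p -> p = x.
Proof.
move=> Bx [_ /(_ x Bx)]; rewrite [gdist x x]distxx leqn0 => /eqP xp.
by rewrite (dist0 xp).
Qed.

Lemma nearestM g h x p : nearest (coset h) x p -> nearest (coset (g * h)%g) (g * x)%g (g * p)%g.
Proof.
move=> [hp pmin]; split; first by rewrite cosetM.
move=> q; rewrite -[q](mulVKg g) cosetM !gdistM; exact: pmin.
Qed.

Lemma within_radj_gdist B r u v : within (radj B) r u v -> (gdist u v <= r)%N.
Proof.
move=> uv; apply/within_gdist; rewrite -[u]/(id u) -[v]/(id v).
by apply: within_homo uv => u' v'; exact: radj_cayley.
Qed.

(** The last vertex may be in [B]: an edge inside [B] needs two vertices there. *)
Lemma path_radj B x s : path e x s ->
  (forall i, (i < size s)%N -> ~ B (nth x (x :: s) i)) -> path (radj B) x s.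
Proof.
move=> es nB; apply/(pathP x) => i si; apply: cayley_radj; first exact/(pathP x).
by case=> /(nB _ si).
Qed.

Lemma nearest_path B x s p : geodesic e x s -> last x s = p -> nearest B x p ->
  path (radj B) x s.
Proof.
move=> gs ls [Bp pmin]; apply: path_radj; first by case: gs.
move=> i si /pmin; rewrite -ls.
by have [-> _] := gdist_split gs (ltnW si);
  rewrite -gdist_size // leqNgt si.
Qed.

Lemma within_far B r u v : (forall q, B q -> (r < gdist u q)%N) ->
  (gdist u v <= r)%N -> within (radj B) r u v.
Proof.
move=> far /within_gdist[s [es ls ss]]; exists s; split=> //.
apply: path_radj => // i si /far; rewrite ltnNge => /negP; apply.
apply/within_gdist; apply: (@within_le _ _ (i - 0)); first by lia.
by have := within_nth es (leq0n i) (ltnW si).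
Qed.

Section Thin.
Variable d : nat.
Hypothesis thin : forall (x y z : G) (p q r : seq G),
    geodesic e x p -> last x p = y ->
    geodesic e y q -> last y q = z ->
    geodesic e z r -> last z r = x ->
    forall i, (i <= size p)%N ->
      (exists2 j, (j <= size q)%N & within e d (nth x (x :: p) i) (nth y (y :: q) j))
   \/ (exists2 j, (j <= size r)%N & within e d (nth x (x :: p) i) (nth z (z :: r) j)).

(** Follow the side from the projection [p] for [2 * d + 2] steps: a path of length
    [2 * d] from there to one of the other sides is too short to return to the
    coset. *)
Lemma leave_projection g x s p q :
  geodesic e x s -> nearest (coset g) x p -> nearest (coset g) (last x s) q ->
  within (radj (coset g)) (2 * (4 * d + 2)) p q \/
  exists2 i, (i <= size s)%N & within (radj (coset g)) (4 * d + 2) p (nth x (x :: s) i).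
Proof.
move=> gs xp yq; set y := last x s in yq; set t := (2 * d + 2)%N.
have [a [ga la]] := geodesic_ex (cayley_connected Ygen) x p.
have pa := nearest_path ga la xp.
have da : size a = gdist x p by rewrite (gdist_size ga) la.
have [at_|ta] := leqP (size a) t.
  right; exists 0 => //=; apply: within_sym; first exact: radj_sym.
  by exists a; split=> //; lia.
pose u := nth x (x :: a) (size a - t).
have [dxu dup] := gdist_split ga (leq_subr t (size a)).
have {}dup : gdist u p = t by move: dup; rewrite la subKn // ltnW.
have ufar w : coset g w -> (t <= gdist u w)%N.
  move=> gw; have := (xp.2 _ gw); have := gdist_triangle u x w.
  by rewrite -da dxu; lia.
have pu : within (radj (coset g)) t p u.
  apply: within_sym; first exact: radj_sym.
  have := within_nth pa (leq_subr t (size a)) (leqnn _).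
  by rewrite subKn ?(ltnW ta)// -/u nth_cons_size la.
have near w : (gdist u w <= 2 * d)%N -> within (radj (coset g)) (4 * d + 2) p w.
  move=> uw; have -> : (4 * d + 2 = t + 2 * d)%N by rewrite /t; lia.
  apply: within_trans pu _; apply: within_far uw => w' /ufar; rewrite /t; lia.
have [b [gb lb]] := geodesic_ex (cayley_connected Ygen) p q.
have [c [gc lc]] := geodesic_ex (cayley_connected Ygen) q x.
have [f [gf lf]] := geodesic_ex (cayley_connected Ygen) y q.
have [[j jb /within_gdist uw]|[j jc /within_gdist uw]] :=
  thin ga la gb lb gc lc (leq_subr t (size a)); rewrite -/u in uw.
  exfalso; have := ufar _ (nearest_mem xp).
  have := gdist_triangle (nth p (p :: b) j) u p.
  have [dpw _] := gdist_split gb jb.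
  rewrite [gdist (nth _ _ _) p]gdistC dpw.
  have := gdist_coset (nearest_mem xp) (nearest_mem yq).
  by rewrite -{1}lb -gdist_size //; rewrite /t; lia.
have [[k ks wz]|[k kf wz]] := thin gc lc gs erefl gf lf jc;
  move/within_gdist in wz.
  right; exists k => //; apply: near.
  by apply: leq_trans (gdist_triangle _ _ _) _; rewrite mul2n -addnn; apply: leq_add uw wz.
left; set z := nth y (y :: f) k in wz.
have pz : within (radj (coset g)) (4 * d + 2) p z.
  apply: near.
  by apply: leq_trans (gdist_triangle _ _ _) _; rewrite mul2n -addnn; apply: leq_add uw wz.
have [dyz dzq] := gdist_split gf kf.
rewrite mul2n -addnn; apply: (within_trans pz).
apply: (@within_le _ _ (size f - k)).
  have := yq.2 _ (nearest_mem xp); have := gdist_triangle z y p.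
  have := within_radj_gdist pz; rewrite gdistC.
  rewrite -{1}lf -gdist_size //.
  by move: dyz; rewrite -/z; lia.
have := within_nth (nearest_path gf lf yq) kf (leqnn _).
by rewrite -/z nth_cons_size lf.
Qed.

Definition detour := (16 * d + 9)%N.

Definition close B r x y : Prop :=
  forall p q, nearest B x p -> nearest B y q -> within (radj B) r p q.

(** The quadrilateral with vertices [x], [last x s] and their projections is thin,
    and its fourth side has length at most one, so the two projections can be joined
    along the other three sides, which avoid the coset. *)
Lemma bounded_projection g x s :
  geodesic e x s -> path (radj (coset g)) x s -> close (coset g) detour x (last x s).
Proof.
move=> gs ps p q xp yq; set W := within (radj (coset g)).
have Wsym : forall r u v, W r u v -> W r v u.
  by move=> r u v; apply: within_sym; exact: radj_sym.
have [pq|[i si pw]] := leave_projection gs xp yq.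
  by apply: within_le pq; rewrite /detour; lia.
pose s' := rev (belast x s).
have s'E : last x s :: s' = rev (x :: s) by rewrite [in RHS]lastI rev_rcons.
have ls' : last (last x s) s' = x.
  by rewrite -[last _ _]/(last x (last x s :: s')) s'E rev_cons last_rcons.
have gs' : geodesic e (last x s) s'.
  apply/(geodesicP (cayley_connected Ygen)); split.
    rewrite /s' rev_path (@eq_path _ _ e); first by case: gs.
    by move=> u v; rewrite /= cayley_sym.
  by rewrite size_rev size_belast ls' (gdist_size gs); exact: gdistC.
have ss' : size s' = size s by rewrite size_rev size_belast.
have [|qp|[j sj qw]] := @leave_projection g (last x s) s' q p gs' yq.
- by rewrite ls'.
- by apply: Wsym; apply: within_le qp; rewrite /detour; lia.
have {qw sj}[j' sj qw] : exists2 j', (j' <= size s)%N & W (4 * d + 2) q (nth x (x :: s) j').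
  exists (size s - j)%N; first exact: leq_subr.
  move: qw; rewrite s'E nth_rev /= ?ltnS -?ss' // ss' subSS.
  by rewrite (set_nth_default x) //= ltnS leq_subr.
have main k l u v : (k <= l)%N -> (l <= size s)%N -> W (4 * d + 2) u (nth x (x :: s) k) ->
    W (4 * d + 2) v (nth x (x :: s) l) -> (gdist u v <= 1)%N -> W detour u v.
  move=> kl ls uk vl uv.
  have := gdist_nth gs kl ls => kldist.
  have := gdist_triangle u (nth x (x :: s) k) (nth x (x :: s) l).
  have := gdist_triangle v u (nth x (x :: s) l); rewrite kldist.
  have := within_radj_gdist uk; have := within_radj_gdist vl.
  rewrite [gdist (nth _ _ k) u]gdistC => vl' uk' h1 h2.
  apply: (@within_le _ _ ((4 * d + 2) + ((l - k) + (4 * d + 2)))).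
    by rewrite /detour; lia.
  apply: within_trans uk _; apply: within_trans (Wsym _ _ _ vl).
  exact: within_nth.
have [ij|ji] := leqP i j'.
  by apply: main pw qw _ => //; apply: gdist_coset (nearest_mem xp) (nearest_mem yq).
apply: Wsym; apply: (main _ _ _ _ (ltnW ji) si qw pw).
exact: gdist_coset (nearest_mem yq) (nearest_mem xp).
Qed.

Hypothesis locally_finite : forall h r, h \in P ->
  finite_set [set h' | h' \in P /\ within (relative_adj P Y) r h h'].

(** Twice [detour], because [behrstock] uses two bounded projections in a row. *)
Definition sep_const := (2 * detour)%N.
Local Notation c := sep_const.

Lemma close_le B r r' x y : (r <= r')%N -> close B r x y -> close B r' x y.
Proof. by move=> rr' xy p q xp yq; apply: within_le rr' (xy p q xp yq). Qed.

Lemma close_sym B r x y : close B r x y -> close B r y x.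
Proof.
by move=> xy p q yp xq; apply: within_sym (xy q p xq yp); exact: radj_sym.
Qed.

Lemma close_trans a r r' x y z :
  close (coset a) r x y -> close (coset a) r' y z -> close (coset a) (r + r') x z.
Proof.
move=> xy yz p q xp zq; have [w yw] := nearest_ex a y.
exact: within_trans (xy p w xp yw) (yz w q yw zq).
Qed.

Lemma close_refl0 a x : close (coset a) (detour) x x.
Proof. by apply: (bounded_projection (x := x) (s := [::])). Qed.

Lemma close_refl a x : close (coset a) c x x.
Proof. by apply: close_le (@close_refl0 a x); rewrite /sep_const; lia. Qed.

Lemma close_coset0 a b b' :
  coset b = coset b' -> coset a <> coset b -> close (coset a) (detour) b b'.
Proof.
move=> bb' ab; have [s [gs ls]] := geodesic_ex (cayley_connected Ygen) b b'.
have bb'1 : (gdist b b' <= 1)%N.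
  by apply: (gdist_coset (mem_coset P b)); rewrite bb'; exact: mem_coset.
have := gdist_size gs; rewrite ls => ss.
rewrite -ls; apply: (bounded_projection gs).
apply: path_radj; first by case: gs.
case=> [|i]; last by lia.
by move=> _ /coset_eq ba; apply: ab.
Qed.

Lemma close_coset a b b' :
  coset b = coset b' -> coset a <> coset b -> close (coset a) c b b'.
Proof. by move=> bb' ab; apply: close_le (close_coset0 bb' ab); rewrite /sep_const; lia. Qed.

(** Of the two cosets take the one nearest to [x]: a shortest path to it avoids
    the other one. *)
Lemma behrstock a b x : coset a <> coset b ->
  close (coset a) c x b \/ close (coset b) c x a.
Proof.
have sep a' b' p q : coset a' <> coset b' -> nearest (coset a') x p -> nearest (coset b') x q ->
    (gdist x q <= gdist x p)%N -> close (coset a') c x b'.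
  move=> N xp xq qp; have bq : coset b' = coset q by rewrite (coset_eq (nearest_mem xq)).
  rewrite /sep_const mul2n -addnn; apply: (@close_trans _ _ _ _ q); last first.
    by apply: close_coset0; rewrite -bq.
  have [s [gs ls]] := geodesic_ex (cayley_connected Ygen) x q.
  rewrite -ls; apply: (bounded_projection gs).
  apply: path_radj; first by case: gs.
  move=> i si /(xp.2 _); have [-> _] := gdist_split gs (ltnW si).
  by have := gdist_size gs; rewrite ls; lia.
have [p xp] := nearest_ex a x; have [q xq] := nearest_ex b x.
move=> N; have [qp|/ltnW pq] := leqP (gdist x q) (gdist x p).
  by left; apply: sep xp xq qp.
by right; apply: sep xq xp pq => //; move/esym.
Qed.

Lemma far_finite x y : exists s, forall a, ~ close (coset a) c x y ->
  exists2 p, p \in s & coset a p.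
Proof.
have [s [gs ls]] := geodesic_ex (cayley_connected Ygen) x y.
exists (x :: s) => a far; apply: contrapT => nex; apply: far.
apply: (@close_le _ (detour)); first by rewrite /sep_const; lia.
rewrite -ls; apply: (bounded_projection gs).
apply: path_radj; first by case: gs.
move=> i si ai; apply: nex; exists (nth x (x :: s) i) => //.
by apply: mem_nth; rewrite /= ltnS ltnW.
Qed.

Lemma ball_finite g p r : coset g p ->
  finite_set [set q | coset g q /\ within (radj (coset g)) r p q].
Proof.
move=> gp; have fin := locally_finite r gp.
apply: sub_finite_set (finite_image (fun q => (g * q)%g) fin).
move=> q [gq pq]; exists (g^-1 * q)%g; last by rewrite mulVKg.
split=> //; apply: within_homo pq => u v.
by rewrite -(radjM P Y g g^-1%g) mulVg radj_relative.
Qed.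

Lemma closeM h g r x y :
  close (coset g) r x y -> close (coset (h * g)%g) r (h * x)%g (h * y)%g.
Proof.
move=> xy p q /(nearestM h^-1%g) + /(nearestM h^-1%g); rewrite !mulKg => xp yq.
rewrite -[p](mulVKg h) -[q](mulVKg h).
by apply: within_homo (xy _ _ xp yq) => u v; rewrite radjM.
Qed.

Local Notation behind := (behind coset close c).
Local Notation snap := (snap coset close c).

Lemma behindM h g a x :
  behind (coset g) a x -> behind (coset (h * g)%g) (h * a)%g (h * x)%g.
Proof.
move=> [ag far]; split; first by move/coset_eqP; rewrite cosetM => /coset_eqP.
move=> b; rewrite -[b](mulVKg h) cosetM => /far {}far /(@closeM h^-1%g).
by rewrite !mulKg.
Qed.

Lemma snapM h g x y : snap (coset g) x y -> snap (coset (h * g)%g) (h * x)%g (h * y)%g.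
Proof.
move=> [n [u [a [<- <- link]]]].
exists n, (fun i => (h * u i)%g), (fun i => (h * a i)%g); split=> // i /link[h1 h2].
by split; exact: behindM.
Qed.

(** The snapped projection is a set, not a point: a snap class can be stable under a
    finite subgroup that acts freely on the coset, and then no point of the coset is
    an equivariant choice. *)
Definition proj B x : set G := [set p | exists2 y, snap B x y & nearest B y p].

Lemma proj_mem B x p : proj B x p -> B p.
Proof. by case=> y _ /nearest_mem. Qed.

Lemma proj_ex g x : exists p, proj (coset g) x p.
Proof. by have [p xp] := nearest_ex g x; exists p, x => //; exact: snap_refl. Qed.

Lemma proj_snap B x y : snap B x y -> proj B x = proj B y.
Proof.
move=> xy; apply/funext => p; apply/propext; split=> -[z xz zp]; exists z => //.
  by apply: snap_trans xz; exact: snap_sym.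
exact: snap_trans xz.
Qed.

Lemma projM h g x p : proj (coset g) x p -> proj (coset (h * g)%g) (h * x)%g (h * p)%g.
Proof. by move=> [y xy yp]; exists (h * y)%g; [exact: snapM | exact: nearestM]. Qed.

Lemma projMP h g x p :
  proj (coset (h * g)%g) (h * x)%g (h * p)%g <-> proj (coset g) x p.
Proof. by split; [move/(projM h^-1%g); rewrite !mulKg | exact: projM]. Qed.

Lemma snap_near g x y : snap (coset g) x y -> close (coset g) (2 * c) x y.
Proof.
apply: snap_close.
- exact: mem_coset.
- exact: close_le.
- by move=> *; exact: close_sym.
- exact: close_trans.
- exact: close_refl.
- exact: behrstock.
Qed.

Lemma proj_near g r x y p q : close (coset g) r x y -> proj (coset g) x p ->
  proj (coset g) y q -> within (radj (coset g)) (4 * c + r) p q.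
Proof.
move=> xy [x' /snap_near/close_sym x'x xp] [y' /snap_near yy' yq].
rewrite (_ : 4 * c + r = 2 * c + (r + 2 * c))%N; last by lia.
exact: (close_trans x'x (close_trans xy yy')).
Qed.

(** A snap class projects into a ball, and balls of cosets are finite. *)
Lemma proj_finite g x : finite_set (proj (coset g) x).
Proof.
have [p xp] := proj_ex g x.
apply: sub_finite_set (@ball_finite g p (4 * c + c) (proj_mem xp)) => q xq.
by split; [exact: proj_mem xq | exact: proj_near (@close_refl g x) xp xq].
Qed.

Lemma proj_inside g x : coset g x -> proj (coset g) x = [set x].
Proof.
move=> gx; have inside y : snap (coset g) x y -> y = x.
  apply: snap_inside gx.
  - exact: close_le.
  - exact: close_refl.
apply/funext => p; apply/propext; split=> [[y /inside -> xp]|->].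
  exact: nearest_self gx xp.
exists x; first exact: snap_refl.
by split=> // q _; rewrite [gdist x x]distxx.
Qed.

Lemma snap_branch b b' x y z : coset b <> coset b' ->
  ~ close (coset b) (12 * c) x y -> ~ close (coset b') (12 * c) x y ->
  ~ close (coset b) (6 * c) x z -> ~ close (coset b') (6 * c) x z ->
  snap (coset b) y z \/ snap (coset b') y z.
Proof.
apply: branch_unique.
- by move=> ? ?; exact: coset_eq.
- exact: close_le.
- by move=> *; exact: close_sym.
- exact: close_trans.
- exact: close_coset.
- exact: behrstock.
Qed.


End Thin.
End Projections.

Local Open Scope ring_scope.

(** * Cochains carried by cosets *)

Section CosetCochains.
Variables (R : realType) (G : groupType) (P : groupClosed G) (H : subGroupType (P : {pred G})).
Implicit Types (b g p q : G) (k : nat).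
Local Notation coset := (coset P).

Definition toH p : H := insubd (1%g : H) p.

Lemma toHK p : p \in P -> val (toH p) = p.
Proof. by move=> Pp; rewrite /toH insubdK. Qed.

Lemma valHM (h h' : H) : val (h * h')%g = (val h * val h')%g :> G.
Proof. exact: gmulfM. Qed.

Lemma valHV (h : H) : val h^-1%g = (val h)^-1%g :> G.
Proof. exact: gmulfV. Qed.

Lemma toHM p q : p \in P -> q \in P -> toH (p * q)%g = (toH p * toH q)%g.
Proof.
by move=> Pp Pq; apply: val_inj; rewrite valHM !toHK //; exact: gpredM.
Qed.

Lemma toHV p : p \in P -> toH p^-1%g = (toH p)^-1%g.
Proof. by move=> Pp; apply: val_inj; rewrite valHV !toHK // gpredV. Qed.

Definition coherent k (y : 'I_k.+1 -> G) := forall i, coset (y ord0) (y i).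

Lemma coherentP k (y : 'I_k.+1 -> G) b :
  (forall i, coset b (y i)) -> coherent y.
Proof. by move=> by_ i; apply: coset_trans (by_ i); exact: coset_sym. Qed.

(** Dividing by the first vertex identifies a coset with the subgroup; for an
    invariant cochain any other base point of the coset would do ([extE]). *)
Definition ext k (phi : cochain R H k.+1) : cochain R G k.+1 := fun y =>
  if `[< coherent y >] then phi (fun i => toH ((y ord0)^-1 * y i)%g) else 0.

Lemma ext_out k (phi : cochain R H k.+1) y : ~ coherent y -> ext phi y = 0.
Proof. by move=> ncoh; rewrite /ext; case: asboolP. Qed.

Lemma extE k (phi : cochain R H k.+1) b y : invariant phi ->
  (forall i, coset b (y i)) -> ext phi y = phi (fun i => toH (b^-1 * y i)%g).
Proof.
move=> iphi by_; rewrite /ext asboolT; last exact: coherentP by_.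
rewrite -[in RHS](iphi (toH (b^-1 * y ord0)%g)); congr phi.
apply/funext => i; rewrite -toHV; last exact: by_.
rewrite -toHM; [|by rewrite gpredV; exact: by_ | exact: by_].
by rewrite invgM invgK mulgA mulgK.
Qed.

Lemma extM k (phi : cochain R H k.+1) g y :
  ext phi (fun i => (g * y i)%g) = ext phi y.
Proof.
rewrite /ext; have -> : coherent (fun i => (g * y i)%g) = coherent y.
  by apply/propext; rewrite /coherent; split=> h i; move: (h i); rewrite cosetM.
case: asboolP => // _; congr phi; apply/funext => i.
by rewrite invgM -mulgA mulKg.
Qed.

Lemma extB k (phi psi : cochain R H k.+1) y :
  ext (phi - psi) y = ext phi y - ext psi y.
Proof. by rewrite /ext; case: asboolP; rewrite ?subr0. Qed.

Lemma ext_delta k (phi : cochain R H k.+1) (y : 'I_k.+2 -> G) : invariant phi ->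
  coherent y ->
  ext (delta phi) y = \sum_(j < k.+2) (-1) ^+ j * ext phi (fun i => y (lift j i)).
Proof.
move=> iphi coh; rewrite {1}/ext asboolT //; apply: eq_bigr => j _; congr (_ * _).
by rewrite (extE iphi (b := y ord0)) // => i; exact: coh.
Qed.

Definition alternating (K : Type) k (phi : cochain R K k) :=
  forall (s : 'S_k) x, phi (x \o s) = (-1) ^+ s * phi x.

Lemma ext_alternating k (phi : cochain R H k.+1) : invariant phi ->
  alternating phi -> alternating (ext phi).
Proof.
move=> iphi aphi s y; have [coh|ncoh] := pselect (coherent y); last first.
  rewrite !ext_out ?mulr0 // => coh; apply: ncoh.
  by apply: (coherentP (b := (y \o s) ord0)) => i; rewrite -[i](permKV s); exact: coh.
rewrite (extE iphi coh) (extE iphi (b := y ord0)) => [|i]; last exact: coh.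
by rewrite -aphi.
Qed.

(** For finite [S] these simplices form finitely many orbits. *)
Definition small (K : groupType) (S : set K) k (x : 'I_k -> K) := forall i j, S ((x i)^-1 * x j)%g.
Definition vanishes_small (K : groupType) (S : set K) k (phi : cochain R K k) :=
  forall x, small S x -> phi x = 0.

Lemma vanishes_small_delta (K : groupType) (S : set K) k (phi : cochain R K k) :
  vanishes_small S phi -> vanishes_small S (delta phi).
Proof.
move=> phi0 x sx; rewrite /delta big1 // => i _.
by rewrite phi0 ?mulr0 // => a b; exact: sx.
Qed.

Lemma invariant_delta (K : groupType) k (phi : cochain R K k) :
  invariant phi -> invariant (delta phi).
Proof.
move=> iphi g; apply/funext => x; rewrite /act /delta; apply: eq_bigr => i _.
by rewrite -[in RHS](iphi g).
Qed.

End CosetCochains.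

(** * Extension of cochains *)

Section Extension.
Variables (R : realType) (G : groupType) (P : groupClosed G)
  (H : subGroupType (P : {pred G})).
Implicit Types (b g p q u v : G) (k : nat).
Local Notation coset := (coset P).

Variables (proj : set G -> G -> set G) (far : set G -> G -> G -> Prop).
Variables (wide : set G -> G -> G -> G -> Prop) (S0 : set H).
Hypothesis proj_mem : forall b x p, proj (coset b) x p -> coset b p.
Hypothesis proj_ex : forall b x, exists p, proj (coset b) x p.
Hypothesis proj_finite : forall b x, finite_set (proj (coset b) x).
Hypothesis projMP : forall g b x p,
  proj (coset (g * b)%g) (g * x)%g (g * p)%g <-> proj (coset b) x p.
Hypothesis proj_inside : forall b x, coset b x -> proj (coset b) x = [set x].
Hypothesis far_irr : forall b x, ~ far (coset b) x x.
Hypothesis far_finite : forall x y, exists s : seq G, forall b, far (coset b) x y ->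
  exists2 p, p \in s & coset b p.
Hypothesis far_inside : forall b b' x y,
  coset b x -> coset b y -> coset b <> coset b' -> ~ far (coset b') x y.
Hypothesis proj_small : forall b x y p q, ~ far (coset b) x y ->
  proj (coset b) x p -> proj (coset b) y q -> S0 (toH H (p^-1 * q)%g).
Hypothesis wide_far : forall b x y z, wide (coset b) x y z -> far (coset b) x y.
Hypothesis far_wide : forall b x y z,
  far (coset b) x y -> wide (coset b) x y z \/ wide (coset b) y x z.
Hypothesis wide_unique : forall b b' x y z, coset b <> coset b' ->
  wide (coset b) x y z -> wide (coset b') x y z ->
  proj (coset b) y = proj (coset b) z \/ proj (coset b') y = proj (coset b') z.

(** The probability that [x] projects to [p] in the coset of [p], for a uniform
    choice in the snapped projection. *)
Definition mu p x : R :=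
  if `[< proj (coset p) x p >] then (#|` fset_set (proj (coset p) x)|%:R)^-1 else 0.

Lemma mu_ge0 p x : 0 <= mu p x.
Proof. by rewrite /mu; case: ifP. Qed.

Lemma mu_proj p x : mu p x != 0 -> proj (coset p) x p.
Proof. by rewrite /mu; case: asboolP; rewrite ?eqxx. Qed.

Lemma muM g p x : mu (g * p)%g (g * x)%g = mu p x.
Proof.
have E : proj (coset (g * p)%g) (g * x)%g = (fun q => g * q)%g @` proj (coset p) x.
  apply/funext => q; apply/propext; split=> [|[q' xq' <-]]; last exact/projMP.
  by rewrite -{1}[q](mulVKg g) => /projMP xq; exists (g^-1 * q)%g; rewrite ?mulVKg.
have -> : mu (g * p)%g (g * x)%g = if `[< proj (coset p) x p >] then
    (#|` fset_set ((fun q => g * q)%g @` proj (coset p) x)|%:R)^-1 else 0.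
  by rewrite /mu (asbool_equiv_eq (projMP g p x p)) E.
rewrite fset_set_image; last exact: proj_finite.
by rewrite card_imfset //=; exact: mulgI.
Qed.

Lemma mu_eq p b x y : coset b p -> proj (coset b) x = proj (coset b) y -> mu p x = mu p y.
Proof. by move=> /coset_eq pb xy; rewrite /mu pb xy. Qed.

Lemma mu_sum1 b x (Z : seq G) : uniq Z -> (forall p, proj (coset b) x p -> p \in Z) ->
  \sum_(p <- Z | `[< coset b p >]) mu p x = 1.
Proof.
move=> uZ xZ; set F := proj (coset b) x in xZ.
transitivity (\sum_(p <- Z | `[< F p >]) (#|` fset_set F|%:R)^-1 : R).
  rewrite [LHS]big_mkcond [RHS]big_mkcond; apply: eq_bigr => p _.
  case: asboolP => [bp|nbp]; first by rewrite /mu (coset_eq bp).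
  by case: asboolP => // /proj_mem.
rewrite big_const_seq iter_addr_0 -[LHS]mulr_natr.
have -> : count (fun p => `[< F p >]) Z = #|` fset_set F|.
  rewrite -size_filter; apply/perm_size/uniq_perm => [||p].
  - exact: filter_uniq.
  - exact: (fset_uniq (fset_set F)).
  - rewrite mem_filter in_fset_set; last exact: proj_finite.
    apply/andP/idP => [[/asboolP Fp _]|/set_mem Fp]; first exact: mem_set.
    by split; [exact/asboolP | exact: xZ].
rewrite mulVf // pnatr_eq0 cardfs_eq0; apply/eqP => F0.
have [p xp] := proj_ex b x.
by have : p \in fset_set F; [rewrite in_fset_set ?inE //; exact: proj_finite | rewrite F0].
Qed.

Lemma mu_inside b p x : coset b x -> coset b p -> mu p x = (p == x)%:R.
Proof.
move=> bx bp; rewrite /mu (coset_eq bp) (proj_inside bx) fset_set1 cardfs1 invr1.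
by case: asboolP => [->|/eqP/negPf ->] //; rewrite eqxx.
Qed.

(** The sum runs over tuples of points rather than over cosets: [ext phi] selects the
    tuples that lie on one coset, and the product of the weights is the law of the
    independent projections of the vertices to that coset. *)
Definition Theta k (phi : cochain R H k.+1) : cochain R G k.+1 := fun x =>
  \sum_(y \in [set: 'I_k.+1 -> G]) ext phi y * \prod_i mu (y i) (x i).

Lemma Theta_invariant k (phi : cochain R H k.+1) : invariant (Theta phi).
Proof.
move=> g; apply/funext => x; rewrite /act /Theta.
rewrite [RHS](reindex_fsbigT (fun y (i : 'I_k.+1) => (g * y i)%g)); last first.
  exists (fun y i => (g^-1 * y i)%g) => y; apply/funext => i.
    by rewrite mulKg.
  by rewrite mulVKg.
apply: eq_fsbigr => y _; rewrite extM; congr (_ * _).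
by apply: eq_bigr => i _; rewrite -[RHS](muM g^-1%g) mulKg.
Qed.

(** Only the cosets that tell two points of [X] apart matter for the simplices with
    vertices in [X]; a list as here turns [Theta] into a sum over a finite type,
    common to a simplex and all of its faces ([ThetaE]). *)
Definition sufficient (X : seq G) (Z : seq G) := uniq Z /\
  forall b, (exists u v, [/\ u \in X, v \in X & far (coset b) u v]) ->
  forall u p, u \in X -> proj (coset b) u p -> p \in Z.

Lemma sufficient_ex X : exists Z, sufficient X Z.
Proof.
have [s sP] : exists s : seq G, forall b,
    (exists u v, [/\ u \in X, v \in X & far (coset b) u v]) ->
    exists2 p, p \in s & coset b p.
  have /choice[f fP] : forall w : G * G, exists s : seq G, forall b,
      far (coset b) w.1 w.2 -> exists2 p, p \in s & coset b p.
    by move=> [u v]; exact: far_finite.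
  exists (flatten [seq f w | w <- [seq (u, v) | u <- X, v <- X]]).
  move=> b [u [v [Xu Xv /(fP (u, v))[p ps bp]]]]; exists p => //.
  apply/flattenP; exists (f (u, v)) => //; apply: map_f.
  by apply/allpairsP; exists (u, v).
have /choice[f fP] : forall w : G * G, exists s : seq G,
    proj (coset w.1) w.2 `<=` [set` s].
  move=> [b x]; have /finite_seqP[l lE] := proj_finite b x.
  by exists l; rewrite -lE.
exists (undup (flatten [seq f w | w <- [seq (b, u) | b <- s, u <- X]])).
split; first exact: undup_uniq.
move=> b /sP[b' b's bb'] u p Xu up; rewrite mem_undup.
apply/flattenP; exists (f (b', u)); last by apply: fP; rewrite /= (coset_eq bb').
by apply: map_f; apply/allpairsP; exists (b', u).
Qed.

Section Sums.
Variables (X Z : seq G).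
Hypothesis XZ : sufficient X Z.
Local Notation N := (size Z).
Local Notation z := (fun l : 'I_N => nth 1%g Z l).
Local Notation tup a := (fun i => nth 1%g Z (a i)).

Lemma z_inj : injective z.
Proof.
by move=> l m /eqP; rewrite nth_uniq ?ltn_ord // => [/eqP/val_inj//|]; case: XZ.
Qed.

Lemma z_mem p : p \in Z -> exists l, z l = p.
Proof.
move=> pZ; have lt : (index p Z < N)%N by rewrite index_mem.
by exists (Ordinal lt); rewrite /= nth_index.
Qed.

Lemma mu_sum_ord b x : (forall p, proj (coset b) x p -> p \in Z) ->
  \sum_(l | `[< coset b (z l) >]) mu (z l) x = 1.
Proof. by move=> /(mu_sum1 XZ.1) <-; rewrite [RHS](big_nth 1%g) big_mkord. Qed.

(** On a coset where no two vertices project far apart the tuple is small, so that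
    [phi] vanishes on it. *)
Lemma term_far k (phi : cochain R H k.+1) (x y : 'I_k.+1 -> G) : vanishes_small S0 phi ->
  ext phi y * \prod_i mu (y i) (x i) != 0 ->
  [/\ coherent P y, forall i, proj (coset (y ord0)) (x i) (y i) &
     exists i j, far (coset (y ord0)) (x i) (x j)].
Proof.
move=> phi0; rewrite mulf_eq0 negb_or => /andP[ey py].
have coh : coherent P y by apply: contrapT => /ext_out ey0; rewrite ey0 eqxx in ey.
have yx i : proj (coset (y ord0)) (x i) (y i).
  rewrite -(coset_eq (coh i)); apply: mu_proj.
  by apply: contraNneq py => mu0; rewrite (bigD1 i) //= mu0 mul0r.
split=> //; apply: contrapT => nfar; case/negP: ey.
rewrite /ext asboolT // phi0 // => i j.
have Ei : ((y ord0)^-1 * y i)%g \in P by exact: coh.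
have Ej : ((y ord0)^-1 * y j)%g \in P by exact: coh.
have -> : ((toH H ((y ord0)^-1 * y i))^-1 * toH H ((y ord0)^-1 * y j))%g =
    toH H ((y i)^-1 * y j)%g.
  by rewrite -toHV // -toHM ?gpredV // invgM invgK -mulgA mulVKg.
by apply: (proj_small (b := y ord0)) (yx i) (yx j) => f; apply: nfar; exists i, j.
Qed.

Lemma term_mem k (phi : cochain R H k.+1) (x y : 'I_k.+1 -> G) : vanishes_small S0 phi ->
  (forall i, x i \in X) ->
  ext phi y * \prod_i mu (y i) (x i) != 0 -> forall i, y i \in Z.
Proof.
move=> phi0 xX /(term_far phi0)[coh yx [i [j fij]]] l.
apply: XZ.2 (yx l) => //.
by exists (x i), (x j).
Qed.

Lemma ThetaE k (phi : cochain R H k.+1) (x : 'I_k.+1 -> G) : vanishes_small S0 phi ->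
  (forall i, x i \in X) ->
  Theta phi x =
  \sum_(a : {ffun 'I_k.+1 -> 'I_N}) ext phi (tup a) * \prod_i mu (tup a i) (x i).
Proof.
move=> phi0 xX; pose r := [seq (fun i => z (a i)) | a : {ffun 'I_k.+1 -> 'I_N}].
rewrite /Theta (fsbigE r) //.
- rewrite /r big_map big_enum_cond /=; apply: eq_bigl => a.
  by rewrite in_setT.
- rewrite map_inj_uniq ?enum_uniq // => a a' aa'.
  by apply/ffunP => i; apply: z_inj; exact: (congr1 (@^~ i) aa').
move=> y _; apply: contraNeq => /(term_mem phi0 xX) yZ.
have /choice[a aP] : forall i, exists l, z l = y i by move=> i; exact: z_mem.
apply/mapP; exists [ffun i => a i]; first exact: mem_enum.
by apply/funext => i; rewrite ffunE aP.
Qed.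

End Sums.

Lemma Theta_sub k (phi psi : cochain R H k.+1) :
  vanishes_small S0 phi -> vanishes_small S0 psi ->
  Theta (phi - psi) = Theta phi - Theta psi.
Proof.
move=> phi0 psi0; apply/funext => x; have [Z XZ] := sufficient_ex (codom x).
have xX i := codom_f x i.
have phipsi0 : vanishes_small S0 (phi - psi).
  by move=> y ys; rewrite -[LHS]/(phi y - psi y) phi0 ?psi0 ?subr0.
rewrite -[RHS]/(Theta phi x - Theta psi x) !(ThetaE XZ) //.
by rewrite -sumrB; apply: eq_bigr => a _; rewrite extB mulrBl.
Qed.

Lemma Theta_inside k (phi : cochain R H k.+1) (x : 'I_k.+1 -> H) :
  invariant phi -> vanishes_small S0 phi -> Theta phi (fun i => val (x i)) = phi x.
Proof.
move=> iphi phi0; pose x' i := val (x i) : G.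
have [Z0 [_ XZ0]] := sufficient_ex (codom x').
pose Z := undup (Z0 ++ codom x').
have XZ : sufficient (codom x') Z.
  split=> [|b bfar u p Xu up]; first exact: undup_uniq.
  by rewrite mem_undup mem_cat (XZ0 _ bfar _ _ Xu up).
have xX i := codom_f x' i.
have x1 i : coset 1%g (x' i) by rewrite /coset /= invg1 mul1g; exact: valP.
have /choice[a aP] : forall i, exists l : 'I_(size Z), nth 1%g Z l = x' i.
  by move=> i; apply: z_mem; rewrite mem_undup mem_cat xX orbT.
pose a0 : {ffun 'I_k.+1 -> 'I_(size Z)} := [ffun i => a i].
have a0E : (fun i => nth 1%g Z (a0 i)) = x'.
  by apply/funext => i; rewrite ffunE aP.
rewrite -[fun i => val (x i)]/x' (ThetaE XZ) // (bigD1 a0) //= [X in _ + X]big1.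
  rewrite a0E addr0 big1 ?mulr1.
    rewrite (extE iphi x1); congr phi; apply/funext => i; apply: val_inj.
    by rewrite invg1 mul1g toHK //; exact: valP.
  by move=> i _; rewrite -[nth _ _ _]/((fun i => nth 1%g Z (a0 i)) i) a0E
    (mu_inside (x1 i) (x1 i)) eqxx.
move=> a1 a10; apply: contraNeq a10 => /(term_far phi0)[coh yx [i [j fij]]].
have E1 : coset 1%g = coset (nth 1%g Z (a1 ord0)).
  by apply: contrapT => N; exact: far_inside (x1 i) (x1 j) N fij.
apply/eqP/ffunP => l; apply: (z_inj XZ).
have := yx l; rewrite proj_inside -?E1 // => ->.
by rewrite -[RHS]/((fun i => nth 1%g Z (a0 i)) l) a0E.
Qed.

Lemma Theta_finite_support (X : seq G) : exists S : set H, finite_set S /\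
  forall k (phi : cochain R H k.+1), vanishes_small S0 phi ->
  (forall x, (forall i, S (x i)) -> phi x = 0) ->
  forall x, (forall i, x i \in X) -> Theta phi x = 0.
Proof.
have [Z XZ] := sufficient_ex X.
exists [set` [seq toH H (p^-1 * q)%g | p <- Z, q <- Z]]; split; first exact: finite_seq.
move=> k phi phi0 phiS x xX; rewrite (ThetaE XZ) // big1 // => a _.
rewrite /ext; case: asboolP => _; last by rewrite mul0r.
rewrite phiS ?mul0r // => i; apply/allpairsP.
by exists (nth 1%g Z (a ord0), nth 1%g Z (a i)); rewrite /= !mem_nth.
Qed.

(** Forgetting the [j]-th vertex of a tuple of the coset integrates out a
    probability measure: this is why [Theta] commutes with the differential. *)
Lemma sum_forget (X Z : seq G) k (phi : cochain R H k.+1) (x : 'I_k.+2 -> G)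
    (j : 'I_k.+2) : sufficient X Z -> (forall i, x i \in X) -> vanishes_small S0 phi ->
  \sum_(a : {ffun 'I_k.+2 -> 'I_(size Z)})
    (if `[< coherent P (fun i => nth 1%g Z (a i)) >]
     then ext phi (fun i => nth 1%g Z (a (lift j i))) else 0) *
    \prod_i mu (nth 1%g Z (a i)) (x i) =
  \sum_(b : {ffun 'I_k.+1 -> 'I_(size Z)})
    ext phi (fun i => nth 1%g Z (b i)) *
    \prod_i mu (nth 1%g Z (b i)) (x (lift j i)).
Proof.
move=> XZ xX phi0; set N := size Z; pose z (l : 'I_N) := nth 1%g Z l.
pose ins (w : {ffun 'I_k.+1 -> 'I_N} * 'I_N) : {ffun 'I_k.+2 -> 'I_N} :=
  [ffun i => if unlift j i is Some i' then w.1 i' else w.2].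
pose del (a : {ffun 'I_k.+2 -> 'I_N}) : {ffun 'I_k.+1 -> 'I_N} * 'I_N :=
  ([ffun i => a (lift j i)], a j).
have insl w i : ins w (lift j i) = w.1 i by rewrite ffunE liftK.
have insj w : ins w j = w.2 by rewrite ffunE unlift_none.
rewrite (reindex ins) /=; last first.
  exists del => [[b l] _|a _]; rewrite /del.
    by congr (_, _); [apply/ffunP => i; rewrite ffunE insl | rewrite insj].
  apply/ffunP => i; rewrite ffunE; case: unliftP => [i' ->|->] //=.
  by rewrite ffunE.
rewrite -(pair_bigA _ (fun (b : {ffun 'I_k.+1 -> 'I_N}) (l : 'I_N) =>
  (if `[< coherent P (fun i => z (ins (b, l) i)) >]
     then ext phi (fun i => z (ins (b, l) (lift j i))) else 0) *
    \prod_i mu (z (ins (b, l) i)) (x i))) /=.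
apply: eq_bigr => b _; set y := fun i => z (b i).
set t := ext phi (fun i => nth 1%g Z (b i)) * _.
have tE : t = ext phi y * \prod_i mu (y i) (x (lift j i)) by [].
have termE l : (if `[< coherent P (fun i => z (ins (b, l) i)) >]
     then ext phi (fun i => z (ins (b, l) (lift j i))) else 0) *
    \prod_i mu (z (ins (b, l) i)) (x i) =
    if `[< coset (y ord0) (z l) >] then t * mu (z l) (x j) else 0.
  rewrite (@bigD1_ord _ _ _ _ j) //= insj /= tE.
  have -> : (fun i => z (ins (b, l) (lift j i))) = y.
    by apply/funext => i; rewrite insl.
  under [X in _ * (_ * X)]eq_bigr do rewrite insl /= -/(y _).
  have [cy|/ext_out ->] := pselect (coherent P y); last first.
    by rewrite !(mul0r, if_same).
  have -> : `[< coherent P (fun i => z (ins (b, l) i)) >] = `[< coset (y ord0) (z l) >].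
    apply: asbool_equiv_eq; split=> [coh|yl].
      have := coh j; rewrite insj /=.
      by apply: coset_trans; apply: coset_sym; have := coh (lift j ord0); rewrite insl.
    apply: (coherentP (b := y ord0)) => i; rewrite ffunE.
    by case: unliftP => [i' _|_] //=; exact: cy.
  by case: asboolP => _; rewrite ?mul0r // mulrCA mulrC.
under eq_bigr do rewrite termE.
have [t0|tn0] := eqVneq t 0.
  by rewrite big1 // => l _; rewrite t0 mul0r if_same.
have [_ _ [i1 [i2 f12]]] := term_far phi0 tn0.
rewrite -big_mkcond -mulr_sumr (mu_sum_ord XZ) ?mulr1 // => p.
apply: XZ.2; last exact: xX.
by exists (x (lift j i1)), (x (lift j i2)).
Qed.

Lemma Theta_delta k (phi : cochain R H k.+1) : invariant phi ->
  vanishes_small S0 phi -> delta (Theta phi) = Theta (delta phi).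
Proof.
move=> iphi phi0; apply/funext => x; have [Z XZ] := sufficient_ex (codom x).
have xX i := codom_f x i.
rewrite (ThetaE XZ) //; last exact: vanishes_small_delta.
rewrite [LHS]/delta; under eq_bigr => j _ do
  rewrite (ThetaE XZ) // -(sum_forget j XZ xX phi0) mulr_sumr.
rewrite exchange_big /=; apply: eq_bigr => a _.
case: asboolP => [coh|ncoh]; last first.
  by rewrite ext_out // mul0r big1 // => j _; rewrite ?mul0r mulr0.
by rewrite ext_delta // mulr_suml; apply: eq_bigr => j _; rewrite mulrA.
Qed.

(** Cosets on which two of the points [x i] have equal snapped projections
    contribute zero, since exchanging these two vertices changes the sign and
    not the weight; each of the other cosets is determined by the indices of a
    [wide] triple. *)
Lemma Theta_bounded k (phi : cochain R H k.+3) (M : R) : invariant phi ->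
  alternating phi -> vanishes_small S0 phi -> 0 <= M -> (forall x, `|phi x| <= M) ->
  forall x, `|Theta phi x| <= (k.+3 ^ 3)%:R * M.
Proof.
move=> iphi aphi phi0 M0 phiM x; have [Z XZ] := sufficient_ex (codom x).
have xX i := codom_f x i.
rewrite (ThetaE XZ) //; set N := size Z; pose z (l : 'I_N) := nth 1%g Z l.
pose T := {ffun 'I_k.+3 -> 'I_N}.
pose B (a : T) := coset (z (a ord0)).
pose f (a : T) : R := ext phi (fun i => z (a i)) * \prod_i mu (z (a i)) (x i).
pose bad_at (i j : 'I_k.+3) (b : set G) := i != j /\ proj b (x i) = proj b (x j).
pose bad (a : T) := `[< exists i j, bad_at i j (B a) >].
pose coh (a : T) := `[< coherent P (fun i => z (a i)) >].
have f0 a : ~~ coh a -> f a = 0 by move/asboolP => /ext_out fa0; rewrite /f fa0 mul0r.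
rewrite -[X in `|X|]/(\sum_(a : T) f a) (bigID bad) /=.
have -> : \sum_(a | bad a) f a = 0.
  (* The transposition depends on the coset only, so that [sw] is an involution. *)
  have /choice[t tP] : forall b : set G, exists t : 'S_k.+3, (exists i j, bad_at i j b) ->
      exists i j, bad_at i j b /\ t = tperm i j.
    move=> b; have [[i [j ij]]|nb] := pselect (exists i j, bad_at i j b).
      by exists (tperm i j) => _; exists i, j.
    by exists 1%g.
  pose sw (a : T) : T := [ffun i => a (t (B a) i)].
  have Bsw a : coh a -> B (sw a) = B a.
    by move=> /asboolP ca; rewrite /B ffunE; apply/coset_eq; exact: ca.
  have cohsw a : coh a -> coh (sw a).
    move=> /asboolP ca; apply/asboolP.
    by apply: (coherentP (b := z (a ord0))) => i; rewrite ffunE; exact: ca.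
  have swK a : bad a -> coh a -> sw (sw a) = a.
    move=> /asboolP ba ca; apply/ffunP => i; rewrite ffunE Bsw // ffunE.
    by have [i1 [j1 [_ ->]]] := tP _ ba; rewrite tpermK.
  have fsw a : bad a -> coh a -> f (sw a) = - f a.
    move=> /asboolP ba /asboolP ca; have [i1 [j1 [[ij xij] tE]]] := tP _ ba.
    rewrite /f -mulNr; congr (_ * _).
      have := ext_alternating iphi aphi (t (B a)) (fun i => z (a i)).
      have -> : odd_perm (t (B a)) = true by rewrite tE odd_tperm ij.
      rewrite expr1 mulN1r => <-.
      by congr (ext phi); apply/funext => i; rewrite /= ffunE.
    rewrite (reindex_perm (t (B a))) /=; apply: eq_bigr => i _.
    rewrite ffunE; have -> : t (B a) (t (B a) i) = i by rewrite tE tpermK.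
    apply: (mu_eq (b := z (a ord0))); first exact: ca.
    by rewrite tE; case: tpermP => [->|->|//].
  have badsw a : bad a -> coh a -> bad (sw a) by rewrite /bad => ba ca; rewrite Bsw.
  rewrite (bigID coh) /= [X in _ + X]big1 ?addr0; last by move=> a /andP[_ /f0].
  set s := \sum_(_ | _) _.
  suff : s = - s by move/eqP; rewrite -addr_eq0 -mulr2n mulrn_eq0 => /eqP.
  rewrite {1}/s (reindex_onto sw sw) /=; last by move=> a /andP[ba ca]; exact: swK.
  rewrite -sumrN; apply: eq_big => [a|a /andP[/andP[ba ca] /eqP sE]]; last first.
    by have := fsw _ ba ca; rewrite sE => ->; rewrite opprK.
  apply/andP/andP => [[/andP[ba ca] /eqP <-]|[ba ca]].
    by split; [exact: badsw | exact: cohsw].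
  by split; [apply/andP; split; [exact: badsw | exact: cohsw] | apply/eqP/swK].
(* By [wide_unique], each triple of indices accounts for one coset, and the weights
   of the tuples on one coset add up to one. *)
rewrite add0r; pose I3 := ('I_k.+3 * ('I_k.+3 * 'I_k.+3))%type.
pose typ (w : I3) (a : T) :=
  [&& ~~ bad a, coh a & `[< w.2.1 != w.2.2 /\ wide (B a) (x w.1) (x w.2.1) (x w.2.2) >]].
pose wt (a : T) : R := \prod_i mu (z (a i)) (x i).
have wt_ge0 a : 0 <= wt a by apply: prodr_ge0 => i _; exact: mu_ge0.
have fle a : ~~ bad a -> `|f a| <= \sum_(w : I3 | typ w a) M * wt a.
  move=> ba; have [->|fa0] := eqVneq (f a) 0.
    by rewrite normr0 sumr_ge0 // => w _; rewrite mulr_ge0.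
  have [ca _ [i [j fij]]] := term_far phi0 fa0.
  have ij : i != j by apply: contraPneq fij => ->; exact: far_irr.
  have [l [li lj]] : exists l : 'I_k.+3, l != i /\ l != j.
    have /subsetPn[l _] : ~~ ('I_k.+3 \subset [:: i; j]).
      apply/negP => /subset_leq_card; rewrite card_ord leqNgt => /negP; apply.
      exact: leq_ltn_trans (card_size _) _.
    by rewrite !inE negb_or => /andP[li lj]; exists l.
  have [w wP] : exists w : I3, typ w a.
    have {}ca : coh a by apply/asboolP.
    rewrite /typ ba ca /=.
    have [W|W] := far_wide (x l) fij.
      by exists (i, (j, l)); apply/asboolP; split=> //=; rewrite eq_sym.
    by exists (j, (i, l)); apply/asboolP; split=> //=; rewrite eq_sym.
  rewrite (bigD1 w) //= ler_wpDr ?sumr_ge0 // => [w' _|]; first by rewrite mulr_ge0.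
  rewrite -[f a]/((ext phi (fun i => z (a i)) : R) * wt a) normrM (ger0_norm (wt_ge0 a)).
  rewrite ler_wpM2r //.
  by rewrite /ext; case: asboolP => // _; rewrite normr0.
apply: le_trans (ler_norm_sum _ _ _) _; apply: (le_trans (ler_sum _ fle)).
rewrite (exchange_big_dep xpredT) //=.
have <- : \sum_(w : I3) M = (k.+3 ^ 3)%:R * M.
  by rewrite sumr_const !card_prod !card_ord mulr_natl expnS expnS expn1.
apply: ler_sum => w _; rewrite -mulr_sumr -[leRHS]mulr1 ler_wpM2l //.
have [[a0 a0w]|na0] := pselect (exists a, typ w a); last first.
  by rewrite big1 // => a /andP[_ aw]; case: na0; exists a.
have {a0w} /and3P[ba0 ca0 /asboolP[w12 W0]] := a0w.
have allE a : typ w a -> forall i, B a0 (z (a i)).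
  move=> /and3P[ba ca /asboolP[_ W]] i.
  suff <- : B a = B a0 by move/asboolP: ca => /(_ i).
  apply: contrapT => neB.
  have [E|E] := wide_unique neB W W0.
    by case/negP: ba; apply/asboolP; exists w.2.1, w.2.2.
  by case/negP: ba0; apply/asboolP; exists w.2.1, w.2.2.
apply: (@le_trans _ _ (\sum_(a in ffun_on (fun l => `[< B a0 (z l) >])) wt a)).
  rewrite [leRHS](bigID (typ w)) /= ler_wpDr ?sumr_ge0 //.
  rewrite le_eqVlt; apply/orP; left; apply/eqP/eq_bigl => a.
  apply/andP/andP => [[ba aw]|[_ aw]]; last by case/and3P: (aw).
  by split=> //; apply/ffun_onP => i; apply/asboolP/allE.
rewrite -(bigA_distr_big (fun l => `[< B a0 (z l) >]) (fun i l => mu (z l) (x i))) /=.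
rewrite big1 // => i _.
apply: (mu_sum_ord XZ (b := z (a0 ord0))) => p; apply: XZ.2 (xX i).
by exists (x w.1), (x w.2.1); rewrite !xX; split=> //; exact: wide_far W0.
Qed.

End Extension.

(** The set [S0] contains the differences of projections to a coset that are not far
    apart.  In [ext_bounded] the exponent counts the triples of vertices, each of
    which accounts for one coset. *)
Record extension_operator (R : realType) (G : groupType) (P : {pred G})
    (H : subGroupType P) (S0 : set H)
    (E : forall k, cochain R H k.+1 -> cochain R G k.+1) : Prop := {
  ext_fin : finite_set S0;
  ext_invariant : forall k (phi : cochain R H k.+1), invariant (E k phi);
  ext_sub : forall k (phi psi : cochain R H k.+1),
    vanishes_small S0 phi -> vanishes_small S0 psi ->
    E k (phi - psi) = E k phi - E k psi;
  ext_restrict : forall k (phi : cochain R H k.+1) x,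
    invariant phi -> vanishes_small S0 phi -> E k phi (fun i => val (x i)) = phi x;
  ext_support : forall X : seq G, exists S : set H, finite_set S /\
    forall k (phi : cochain R H k.+1), vanishes_small S0 phi ->
    (forall x, (forall i, S (x i)) -> phi x = 0) ->
    forall x, (forall i, x i \in X) -> E k phi x = 0;
  ext_commutes : forall k (phi : cochain R H k.+1), invariant phi ->
    vanishes_small S0 phi -> delta (E k phi) = E k.+1 (delta phi);
  ext_bounded : forall k (phi : cochain R H k.+3) (M : R), invariant phi ->
    alternating phi -> vanishes_small S0 phi -> 0 <= M -> (forall x, `|phi x| <= M) ->
    forall x, `|E k.+2 phi x| <= (k.+3 ^ 3)%:R * M
}.

(** The thresholds: projections are far if they are not [12 * c]-close, since a
    coset where [x] and [y] are far must still separate one of them from a third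
    point by [6 * c].  Snapping moves each projection by at most [2 * c], so that
    snapped projections of points that are not far lie within [16 * c]. *)
Lemma extension_operator_ex (R : realType) (G : groupType) (P : groupClosed G)
    (H : subGroupType (P : {pred G})) : hyperbolically_embedded P ->
  exists S0 E, @extension_operator R G P H S0 E.
Proof.
move=> [Y [Ygen [d thin] fin]]; pose c := sep_const d.
pose far (B : set G) x y := ~ close Ygen B (12 * c)%N x y.
pose wide (B : set G) x y z := far B x y /\ ~ close Ygen B (6 * c)%N x z.
pose pr := proj Ygen d.
pose S0 : set H :=
  toH H @` [set h' | h' \in P /\ within (relative_adj P Y) (16 * c) 1%g h'].
have S0_fin : finite_set S0 by apply/finite_image/fin; exact: gpred1.
have pr_mem b x p : pr (coset P b) x p -> coset P b p by exact: proj_mem.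
have pr_nonempty b x : exists p, pr (coset P b) x p by exact: proj_ex.
have pr_finite b x : finite_set (pr (coset P b) x) by exact: (proj_finite Ygen thin fin).
have prM g b x p : pr (coset P (g * b)%g) (g * x)%g (g * p)%g <-> pr (coset P b) x p.
  exact: projMP.
have pr_inside b x : coset P b x -> pr (coset P b) x = [set x] by exact: (proj_inside Ygen thin).
have cc : (c <= 12 * c)%N by lia.
have far_irr b x : ~ far (coset P b) x x.
  by apply; apply: (close_le cc); exact: (close_refl thin).
have far_fin x y : exists s : seq G, forall b, far (coset P b) x y ->
    exists2 p, p \in s & coset P b p.
  have [s sP] := far_finite Ygen thin x y; exists s => b bxy.
  by apply: sP => h; apply: bxy; exact: (close_le cc h).
have far_inside b b' x y : coset P b x -> coset P b y -> coset P b <> coset P b' ->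
    ~ far (coset P b') x y.
  move=> bx by_ bb'; apply; apply: (close_le cc); apply: (close_coset thin).
    by rewrite (coset_eq bx) (coset_eq by_).
  by rewrite (coset_eq bx) => /esym.
have pr_small b x y p q : ~ far (coset P b) x y ->
    pr (coset P b) x p -> pr (coset P b) y q -> S0 (toH H (p^-1 * q)%g).
  move=> /contrapT xy xp yq.
  have pq := proj_near thin xy xp yq; have bp := proj_mem xp.
  exists (p^-1 * q)%g => //; split.
    have := proj_mem yq; rewrite -(coset_eq bp); exact.
  rewrite -(mulVg p); apply: within_homo (_ : within (radj P Y (coset P p)) _ p q).
    by move=> u v; rewrite -(radjM P Y p p^-1%g) mulVg radj_relative.
  by rewrite (coset_eq bp); apply: within_le pq; lia.
have wide_far b x y z : wide (coset P b) x y z -> far (coset P b) x y by case.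
have far_wide b x y z : far (coset P b) x y ->
    wide (coset P b) x y z \/ wide (coset P b) y x z.
  move=> xy; have [xz|xz] := pselect (close Ygen (coset P b) (6 * c)%N x z); last by left.
  right; split=> [/close_sym//|yz]; apply: xy.
  rewrite (_ : 12 * c = 6 * c + 6 * c)%N; last by lia.
  exact: close_trans xz (close_sym yz).
have wide_unique b b' x y z : coset P b <> coset P b' ->
    wide (coset P b) x y z -> wide (coset P b') x y z ->
    pr (coset P b) y = pr (coset P b) z \/ pr (coset P b') y = pr (coset P b') z.
  move=> bb' [xy xz] [x'y x'z].
  by have [h|h] := snap_branch thin bb' xy x'y xz x'z; [left|right]; exact: proj_snap h.
exists S0, (fun k => @Theta R G P H pr k); split=> //.
- exact: Theta_invariant pr_finite prM.
- move=> k phi psi; exact: (Theta_sub pr_finite far_fin pr_small).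
- move=> k phi x; exact: (Theta_inside pr_finite pr_inside far_fin far_inside pr_small).
- exact: (Theta_finite_support R pr_finite far_fin pr_small).
- move=> k phi.
  exact: (Theta_delta pr_mem pr_nonempty pr_finite far_fin pr_small).
- move=> k phi M.
  exact: (Theta_bounded pr_mem pr_nonempty pr_finite far_irr far_fin pr_small
    wide_far far_wide wide_unique).
Qed.

(** * Alternating cochains *)

Section Alternation.
Variables (R : realType) (K : groupType).
Implicit Types (k : nat) (g : K) (M : R).
Local Notation C k := (cochain R K k).

Lemma cochainD k (phi psi : C k) x : (phi + psi) x = phi x + psi x. Proof. by []. Qed.
Lemma cochainB k (phi psi : C k) x : (phi - psi) x = phi x - psi x. Proof. by []. Qed.
Lemma cochainN k (phi : C k) x : (- phi) x = - phi x. Proof. by []. Qed.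
Lemma cochain0 k x : (0 : C k) x = 0. Proof. by []. Qed.

(** The face omitting two vertices occurs twice, with opposite signs, according
    to the order in which they are omitted. *)
Lemma delta_delta k (phi : C k) : delta (delta phi) = 0.
Proof.
apply/funext => x; rewrite cochain0 {1}/delta.
under eq_bigr => i _ do rewrite /delta mulr_sumr.
rewrite pair_bigA /=; pose F (p : 'I_k.+2 * 'I_k.+1) : R :=
  (-1) ^+ p.1 * ((-1) ^+ p.2 * phi (fun j => x (lift p.1 (lift p.2 j)))).
rewrite -[LHS]/(\sum_p F p).
pose sw (p : 'I_k.+2 * 'I_k.+1) : 'I_k.+2 * 'I_k.+1 :=
  if (p.2 < p.1)%N then (inord p.2, inord p.1.-1) else (inord p.2.+1, inord p.1).
have swE p : (sw p).1 = (if (p.2 < p.1)%N then p.2 : nat else p.2.+1) :> nat /\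
    (sw p).2 = (if (p.2 < p.1)%N then p.1.-1 else p.1 : nat) :> nat.
  have i1 := ltn_ord p.1; have i2 := ltn_ord p.2; rewrite /sw.
  by case: ltnP => ji /=; rewrite !inordK //; lia.
have sw1 p := (swE p).1; have sw2 p := (swE p).2.
have swK : involutive sw.
  move=> [i j]; apply: injective_projections; apply: ord_inj;
    rewrite ?(sw1 (sw _)) ?(sw2 (sw _)) sw1 sw2 /=; case: ifP; case: ifP; lia.
have Fsw p : F (sw p) = - F p.
  rewrite /F !mulrA -!exprD -mulNr; congr (_ * _).
    rewrite -[RHS]mulN1r -exprS.
    rewrite -signr_odd -[RHS]signr_odd; congr (_ ^+ _); rewrite !sw1 !sw2 /=.
    by case: ifP; lia.
  congr phi; apply/funext => t; congr x; apply: ord_inj => /=.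
  rewrite !sw1 !sw2 /bump /=; case: ifP; lia.
suff : \sum_p F p = - \sum_p F p.
  by move/eqP; rewrite -addr_eq0 -mulr2n mulrn_eq0 => /eqP.
by rewrite {1}(reindex_inj (inv_inj swK)) -sumrN; apply: eq_bigr => p _; exact: Fsw.
Qed.

Definition alt k (phi : C k) : C k := fun x =>
  (k`!%:R)^-1 * \sum_(s : 'S_k) (-1) ^+ s * phi (x \o s).

Lemma fact_neq0 k : k`!%:R != 0 :> R.
Proof. by rewrite pnatr_eq0 -lt0n fact_gt0. Qed.

Lemma alternating_alt k (phi : C k) : alternating (alt phi).
Proof.
move=> t x; rewrite /alt [RHS]mulrCA; congr (_ * _).
rewrite mulr_sumr (reindex_inj (mulIg t^-1%g)) /=; apply: eq_bigr => s _.
rewrite mulrA -signr_addb odd_permM odd_permV addbC; congr (_ * phi _).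
by apply/funext => i; rewrite /= permM permKV.
Qed.

Lemma alt_id k (phi : C k) : alternating phi -> alt phi = phi.
Proof.
move=> aphi; apply/funext => x; rewrite /alt.
under eq_bigr => s _ do rewrite aphi mulrA -signr_addb addbb mul1r.
by rewrite sumr_const card_Sn -[phi x *+ _]mulr_natl mulKf // fact_neq0.
Qed.

Lemma alt1 (phi : C 1) : alt phi = phi.
Proof.
apply: alt_id => s x; have -> : s = 1%g by apply/permP => i; rewrite !ord1.
by rewrite odd_perm1 mul1r; congr phi; apply/funext => i; rewrite /= perm1.
Qed.

Lemma altB k (phi psi : C k) : alt (phi - psi) = alt phi - alt psi.
Proof.
apply/funext => x; rewrite cochainB /alt -mulrBr -sumrB; congr (_ * _).
by apply: eq_bigr => s _; rewrite -mulrBr.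
Qed.

Lemma alt_act k g (phi : C k) : alt (act g phi) = act g (alt phi).
Proof. by []. Qed.

Lemma alt_invariant k (phi : C k) : invariant phi -> invariant (alt phi).
Proof. by move=> iphi g; rewrite -alt_act iphi. Qed.

Lemma alt_le k (phi : C k) M : (forall x, `|phi x| <= M) -> forall x, `|alt phi x| <= M.
Proof.
move=> phiM x; rewrite /alt normrM ger0_norm ?invr_ge0 //.
rewrite ler_pdivrMl; last by rewrite lt0r fact_neq0 ler0n.
apply: le_trans (ler_norm_sum _ _ _) _.
apply: (@le_trans _ _ (\sum_(s : 'S_k) M)).
  by apply: ler_sum => s _; rewrite normrM normr_sign mul1r.
by rewrite sumr_const card_Sn mulr_natl.
Qed.

Lemma alt_eq0 k (phi : C k) (S : set K) :
  (forall x, (forall i, S (x i)) -> phi x = 0) ->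
  forall x, (forall i, S (x i)) -> alt phi x = 0.
Proof.
move=> phi0 x xS; rewrite /alt big1 ?mulr0 // => s _.
by rewrite phi0 ?mulr0 // => i; exact: xS.
Qed.

(** A permutation of the vertices of a simplex restricts to a permutation of the
    vertices of each of its faces. *)
Lemma delta_alt k (phi : C k) : delta (alt phi) = alt (delta phi).
Proof.
apply/funext => x; rewrite /alt /delta.
pose A (j : 'I_k.+1) (t : 'S_k) : R := (-1) ^+ j * ((-1) ^+ t * phi (fun l => x (lift j (t l)))).
have term (i : 'I_k.+1) : \sum_(s : 'S_k.+1) (-1) ^+ s * ((-1) ^+ i * phi (fun l => x (s (lift i l)))) =
    \sum_j \sum_(t : 'S_k) A j t.
  rewrite pair_bigA; pose h (w : 'I_k.+1 * 'S_k) := lift_perm i w.1 w.2.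
  have h_inj : injective h.
    move=> [j t] [j' t'] /permP hE.
    have jj' : j = j' by have := hE i; rewrite /h /= !lift_perm_id.
    congr (_, _) => //; apply/permP => l; apply: (@lift_inj _ j).
    by have := hE (lift i l); rewrite /h /= !lift_perm_lift -jj'.
  have h_bij : bijective h.
    by apply: inj_card_bij h_inj _; rewrite card_prod !card_Sn card_ord factS.
  rewrite (reindex h) /=; last exact: onW_bij.
  apply: eq_bigr => [[j t]] _; rewrite /A /h /= odd_lift_perm 2!signr_addb (signr_odd _ i) (signr_odd _ j).
  rewrite -!mulrA mulrCA; congr (_ * _).
  rewrite [X in _ * X = _]mulrCA [LHS]mulrA -expr2 sqrr_sign mul1r; congr (_ * phi _).
  by apply/funext => l; rewrite lift_perm_lift.
under eq_bigr => i _ do rewrite mulrCA mulr_sumr.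
rewrite -mulr_sumr.
under [in RHS]eq_bigr => s _ do rewrite mulr_sumr.
rewrite [in RHS]exchange_big /=; under [in RHS]eq_bigr => i _ do rewrite term.
rewrite sumr_const card_ord -[_ *+ k.+1]mulr_natl [RHS]mulrA factS natrM invfM.
rewrite [_ * k.+1%:R]mulrAC mulVf ?pnatr_eq0 // mul1r.
by congr (_ * _); apply: eq_bigr => i _; rewrite mulr_sumr.
Qed.
Lemma alternating_delta k (phi : C k) : alternating phi -> alternating (delta phi).
Proof. by move=> /alt_id <-; rewrite delta_alt; exact: alternating_alt. Qed.

Definition cone (y : K) k (phi : C k.+1) : C k := fun x =>
  phi (fun i => if unlift ord0 i is Some j then x j else y).

Lemma cone_delta y k (phi : C k.+1) : cone y (delta phi) = phi - delta (cone y phi).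
Proof.
apply/funext => x; rewrite cochainB /cone /delta big_ord_recl /= mul1r -sumrN.
congr (_ + _); first by congr phi; apply/funext => j; rewrite liftK.
apply: eq_bigr => i _; rewrite exprS mulN1r mulNr; congr (- (_ * phi _)).
apply/funext => j; case: (unliftP ord0 j) => [l ->|->].
  have -> : lift (lift ord0 i) (lift ord0 l) = lift ord0 (lift i l) :> 'I_k.+2.
    by apply: ord_inj; rewrite /= /bump /=; lia.
  by rewrite !liftK.
have -> : lift (lift ord0 i) ord0 = ord0 :> 'I_k.+2 by apply: ord_inj.
by rewrite !unlift_none.
Qed.

Lemma cone_act y g k (phi : C k.+1) :
  cone y (act g phi) = act g (cone (g^-1 * y)%g phi).
Proof.
apply/funext => x; rewrite /cone /act; congr phi; apply/funext => i.
by case: unliftP.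
Qed.

Lemma coneB y k (phi psi : C k.+1) : cone y (phi - psi) = cone y phi - cone y psi.
Proof. by []. Qed.

(** The chain homotopy from the identity to [alt], built by coning off with the
    first vertex; choosing that vertex as apex makes it equivariant. *)
Fixpoint alt_homotopy k : C k.+1 -> C k :=
  if k is k'.+1 then fun phi x =>
    let c := cone (x ord0) phi in (c - alt c - delta (alt_homotopy c)) x
  else fun=> 0.

Lemma alt_homotopyS k (phi : C k.+2) x : alt_homotopy phi x =
  (cone (x ord0) phi - alt (cone (x ord0) phi) -
   delta (alt_homotopy (cone (x ord0) phi))) x.
Proof. by []. Qed.

Lemma deltaB k (phi psi : C k) : delta (phi - psi) = delta phi - delta psi.
Proof. exact: linearB. Qed.

Lemma delta0 k : delta (0 : C k) = 0.
Proof. exact: linear0. Qed.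

Lemma alt_homotopyB k (phi psi : C k.+1) :
  alt_homotopy (phi - psi) = alt_homotopy phi - alt_homotopy psi.
Proof.
elim: k phi psi => [|k IH] phi psi; first by rewrite /= subr0.
apply/funext => x; rewrite cochainB !alt_homotopyS coneB altB IH deltaB !cochainB.
by rewrite !opprB !addrA [LHS]addrC; ring.
Qed.

Lemma alt_homotopy_act k g (phi : C k.+1) :
  alt_homotopy (act g phi) = act g (alt_homotopy phi).
Proof.
elim: k phi => [|k IH] phi //; apply/funext => x.
by rewrite [RHS]/act !alt_homotopyS cone_act alt_act IH.
Qed.

(** By induction, since coning with a fixed apex contracts the complex
    ([cone_delta]). *)
Lemma alt_homotopyP k (phi : C k.+1) :
  phi - alt phi = delta (alt_homotopy phi) + alt_homotopy (delta phi).
Proof.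
elim: k phi => [|k IH] phi.
  have h0 (psi : C 1) : alt_homotopy psi = 0 by [].
  apply/funext => x; rewrite alt1 subrr h0 delta0 add0r alt_homotopyS.
  by rewrite alt1 subrr sub0r h0 delta0 oppr0.
apply/funext => x; rewrite [RHS]cochainD alt_homotopyS cone_delta altB alt_homotopyB deltaB.
have := IH (cone (x ord0) phi) => /(congr1 (@delta R K k.+1)).
rewrite deltaB delta_alt raddfD /= delta_delta add0r => <-.
by rewrite !cochainB; ring.
Qed.

Lemma delta_le k (phi : C k) M : (forall x, `|phi x| <= M) ->
  forall x, `|delta phi x| <= k.+1%:R * M.
Proof.
move=> phiM x; apply: le_trans (ler_norm_sum _ _ _) _.
apply: (@le_trans _ _ (\sum_(i < k.+1) M)).
  by apply: ler_sum => i _; rewrite normrM normrX normrN1 expr1n mul1r.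
by rewrite sumr_const card_ord mulr_natl.
Qed.

Lemma alt_homotopy_le k : exists c : R, forall (phi : C k.+1) M,
  (forall x, `|phi x| <= M) -> forall x, `|alt_homotopy phi x| <= c * M.
Proof.
elim: k => [|k [c IH]]; first by exists 0 => phi M _ x; rewrite normr0 mul0r.
exists (2 + k.+1%:R * c) => phi M phiM x; rewrite alt_homotopyS !cochainB.
have cM y : `|cone (x ord0) phi y| <= M by exact: phiM.
have dM := delta_le (IH _ _ cM) x; have aM := alt_le cM x.
apply: le_trans (ler_normB _ _) _; rewrite mulrDl -mulrA lerD //.
by apply: le_trans (ler_normB _ _) _; rewrite mulr_natl mulr2n lerD.
Qed.

End Alternation.

(** * One coefficient vector for all finite sets *)

Lemma half_margin (R : realFieldType) (x d : R) : 0 <= x -> 0 <= d ->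
  x * (d / (2 * (x + 1))) <= d / 2.
Proof.
move=> x0 d0; have x1 : 0 < x + 1 by rewrite ltr_wpDl.
rewrite mulrA ler_pdivrMr ?mulr_gt0 // mulrA divfK ?pnatr_eq0 //.
by rewrite mulrC ler_wpM2l // lerDl.
Qed.

Section Selection.
Variables (R : realType) (T : Type) (V : lmodType R).
Implicit Types (S : set T) (v w z : V) (M m t r : R).

(** [N S m v] is to be thought of as a bound by [m] on a seminorm of [v] that
    increases with [S]. *)
Record graded_bound (N : set T -> R -> V -> Prop) : Prop := {
  gb_mono : forall S S' m m' v, S `<=` S' -> m <= m' -> N S' m v -> N S m' v;
  gb_add : forall S m m' v w, N S m v -> N S m' w -> N S (m + m') (v + w);
  gb_scale : forall S m r v, N S m v -> N S (`|r| * m) (r *: v)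
}.

Definition finite_at (N : set T -> R -> V -> Prop) v :=
  forall S, finite_set S -> exists m, N S m v.

(** For fixed [S] and [m], the admissible coefficients form a set [T S m] that
    shrinks as [S] grows and [m] decreases.  Unless [z] has seminorm zero for all
    [S], these sets are eventually bounded, and the supremum of all lower bounds of
    sets [T S m] is in the closure of each of them. *)
Lemma select_coefficient N M v z : graded_bound N -> finite_at N z ->
  (forall S m, finite_set S -> M < m -> exists t, N S m (v + t *: z)) ->
  exists t, forall S m, finite_set S -> M < m -> N S m (v + t *: z).
Proof.
move=> [mono add scale] zfin ex.
have move_t S m t t' r : N S r z -> N S m (v + t *: z) ->
    N S (m + `|t' - t| * r) (v + t' *: z).
  move=> Nz Nt; have -> : v + t' *: z = (v + t *: z) + (t' - t) *: z.
    by rewrite scalerBl -addrA [t *: z + _]addrC subrK.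
  by apply: add => //; exact: scale.
have [deg|nd] := pselect (forall S e, finite_set S -> 0 < e -> N S e z).
  exists 0 => S m Sfin Mm; have [|t Nt] := ex S ((m + M) / 2) Sfin; first by lra.
  pose e := (m - M) / (2 * (`|t| + 1)).
  have t1 : 0 < `|t| + 1 by rewrite ltr_wpDl.
  have e0 : 0 < e by rewrite divr_gt0 ?subr_gt0 ?mulr_gt0.
  apply: mono (move_t _ _ _ 0 _ (deg S e Sfin e0) Nt) => //.
  have : `|t| * e <= (m - M) / 2 by apply: half_margin => //; rewrite subr_ge0 ltW.
  by rewrite sub0r normrN; lra.
have [S1 [e1 [S1fin e1_gt0 nN]]] : exists S1 e1, [/\ finite_set S1, 0 < e1 & ~ N S1 e1 z].
  apply: contrapT => nex; apply: nd => S e Sfin e0; apply: contrapT => nN.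
  by apply: nex; exists S, e.
pose D := `|2 * (M + 1) / e1|.
have near t t' : N S1 (M + 1) (v + t *: z) -> N S1 (M + 1) (v + t' *: z) -> `|t - t'| <= D.
  move=> Nt Nt'; have [->|tt'] := eqVneq t t'; first by rewrite subrr normr0 normr_ge0.
  have tt0 : 0 < `|t - t'| by rewrite normr_gt0 subr_eq0.
  have Nd : N S1 (2 * (M + 1)) ((t - t') *: z).
    have := add _ _ _ _ _ Nt (scale _ _ (-1) _ Nt').
    rewrite normrN1 mul1r -mulr2n mulr_natl scaleN1r opprD addrACA subrr add0r.
    by rewrite scalerBl.
  have := scale _ _ (t - t')^-1 _ Nd.
  rewrite scalerA mulVf ?subr_eq0 // scale1r normfV => Nz.
  apply: le_trans (ler_norm _); rewrite ler_pdivlMr // mulrC leNgt.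
  apply/negP => lt; apply: nN; apply: mono Nz => //.
  by rewrite ler_pdivrMl // [leRHS]mulrC ltW.
pose A := [set a : R | exists S m, [/\ finite_set S, M < m &
  forall t, N S m (v + t *: z) -> a <= t]].
have M1 : M < M + 1 by lra.
have meet S m S' m' : finite_set S -> finite_set S' -> M < m -> M < m' ->
    exists t, N S m (v + t *: z) /\ N S' m' (v + t *: z).
  move=> Sfin S'fin Mm Mm'.
  have [||t Nt] := ex (S `|` S') (Num.min m m').
  - by rewrite finite_setU.
  - by rewrite lt_min Mm.
  exists t; split; apply: mono Nt.
  - exact: subsetUl.
  - by rewrite ge_min lexx.
  - exact: subsetUr.
  - by rewrite ge_min lexx orbT.
have [t0 Nt0] := ex S1 (M + 1) S1fin M1.
have supA : has_sup A.
  split.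
    exists (t0 - D), S1, (M + 1); split=> // t Nt.
    by have := near _ _ Nt0 Nt; have := ler_norm (t0 - t); lra.
  exists (t0 + D) => a [S [m [Sfin Mm low]]].
  have [t [Nt N1t]] := meet _ _ _ _ Sfin S1fin Mm M1.
  by have := low _ Nt; have := near _ _ N1t Nt0; have := ler_norm (t - t0); lra.
exists (sup A) => S m Sfin Mm.
have [r Nr] := zfin S Sfin.
pose e := (m - M) / (2 * (`|r| + 1)).
have r1 : 0 < `|r| + 1 by rewrite ltr_wpDl.
have e0 : 0 < e by rewrite divr_gt0 ?subr_gt0 ?mulr_gt0.
have [a [S' [m' [S'fin Mm' low]]] aA] := sup_adherent e0 supA.
have Mh : M < (m + M) / 2 by lra.
have [t [te Nt lt]] : exists t, [/\ t < sup A + e, N S ((m + M) / 2) (v + t *: z) & a <= t].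
  apply: contrapT => nex.
  suff : A (sup A + e) by move=> /(ub_le_sup supA.2); lra.
  exists (S `|` S'), (Num.min ((m + M) / 2) m'); split.
  - by rewrite finite_setU.
  - by rewrite lt_min Mh.
  move=> t Nt; rewrite leNgt; apply/negP => te; apply: nex; exists t; split=> //.
    by apply: mono Nt; [exact: subsetUl | rewrite ge_min lexx].
  by apply: low; apply: mono Nt; [exact: subsetUr | rewrite ge_min lexx orbT].
apply: mono (move_t _ _ _ (sup A) _ Nr Nt) => //.
have dist : `|sup A - t| <= e by rewrite ler_norml; lra.
have : `|sup A - t| * r <= e * `|r|.
  apply: le_trans (ler_norm _) _; rewrite normrM normr_id; exact: ler_wpM2r.
have : e * `|r| <= (m - M) / 2.
  by rewrite mulrC; apply: half_margin => //; rewrite subr_ge0 ltW.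
lra.
Qed.

Fixpoint combination (s : seq V) : set V :=
  if s is z :: s' then [set w | exists t, exists2 w', combination s' w' & w = t *: z + w']
  else [set 0].

Lemma combination0 s : combination s 0.
Proof. by elim: s => //= z s IH; exists 0, 0; rewrite // scale0r addr0. Qed.

Lemma combinationD s v w : combination s v -> combination s w -> combination s (v + w).
Proof.
elim: s v w => [|z s IH] v w /=; first by move=> -> ->; rewrite addr0.
move=> [t [v' v's ->]] [t' [w' w's ->]]; exists (t + t'), (v' + w'); first exact: IH.
by rewrite scalerDl addrACA.
Qed.

Lemma combinationZ s r v : combination s v -> combination s (r *: v).
Proof.
elim: s v => [|z s IH] v /=; first by move=> ->; rewrite scaler0.
move=> [t [v' v's ->]]; exists (r * t), (r *: v'); first exact: IH.
by rewrite scalerDr scalerA.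
Qed.

Lemma combination_sum (I : Type) (l : seq I) (e : I -> V) (c : I -> R) :
  combination [seq e i | i <- l] (\sum_(i <- l) c i *: e i).
Proof.
elim: l => [|i l IH] /=; first by rewrite big_nil.
by rewrite big_cons; exists (c i), (\sum_(j <- l) c j *: e j).
Qed.

(** One coefficient at a time: existence of the remaining coefficients is again a
    graded bound. *)
Lemma select_combination N M (s : seq V) v : graded_bound N ->
  {in s, forall z, finite_at N z} ->
  (forall S m, finite_set S -> M < m -> exists2 w, combination s w & N S m (v + w)) ->
  exists2 w, combination s w & forall S m, finite_set S -> M < m -> N S m (v + w).
Proof.
move=> Ngb; elim: s v => [|z s IH] v sfin ex.
  by exists 0 => // S m Sfin Mm; have [w ->] := ex S m Sfin Mm.
pose N' S m v' := exists2 w, combination s w & N S m (v' + w).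
have N'gb : graded_bound N'.
  split=> [S S' m m' v' SS' mm' [w ws Nw]|S m m' v1 v2 [w1 w1s N1] [w2 w2s N2]|
           S m r v' [w ws Nw]].
  - by exists w => //; exact: gb_mono Ngb _ _ _ _ _ SS' mm' Nw.
  - by exists (w1 + w2); [exact: combinationD | rewrite addrACA; exact: gb_add].
  - by exists (r *: w); [exact: combinationZ | rewrite -scalerDr; exact: gb_scale].
have z'fin : finite_at N' z.
  move=> S Sfin; have [m Nm] := sfin z (mem_head _ _) S Sfin.
  by exists m, 0; [exact: combination0 | rewrite addr0].
have [|t Nt] := select_coefficient N'gb z'fin (M := M) (v := v).
  move=> S m Sfin Mm; have [_ [t [w ws ->]] Nw] := ex S m Sfin Mm.
  by exists t, w => //; rewrite -addrA.
have [|w ws Nw] := IH (v + t *: z) _ Nt; first by move=> z' z's; apply: sfin; rewrite in_cons z's orbT.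
by exists (t *: z + w); [exists t, w | move=> S m Sfin Mm; rewrite addrA; exact: Nw].
Qed.

End Selection.

Local Open Scope quotient_scope.

(** * Primitives of bounded classes *)

Section Primitives.
Variables (R : realType) (K : groupType).
Implicit Types (k n : nat) (b : bool).
Local Notation C k := (cochain R K k).

Lemma class_eqP b n (z z' : cocycle R K b n) : class z = class z' <->
  exists2 phi : C n, in_complex b phi & delta phi = val z - val z'.
Proof.
rewrite /class; split=> [/eqP|[phi Cphi dphi]].
  by rewrite quot_pi_eq => /asboolP[phi Cphi dphi]; exists phi.
by apply/eqP; rewrite quot_pi_eq; apply/asboolP; exists phi.
Qed.

Lemma class0P b n (z : cocycle R K b n) : class z = 0 <->
  exists2 phi : C n, in_complex b phi & delta phi = val z.
Proof.
have -> : 0 = class (0 : cocycle R K b n).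
  by apply: (addrI (class 0)); rewrite addr0 /class -quot_piD addr0.
by rewrite class_eqP /= subr0.
Qed.

Lemma in_complexB b k (phi psi : C k) :
  in_complex b phi -> in_complex b psi -> in_complex b (phi - psi).
Proof.
by move=> Cphi Cpsi; rewrite addrC -scaleN1r; exact: in_complexP.
Qed.

Lemma in_complexD b k (phi psi : C k) :
  in_complex b phi -> in_complex b psi -> in_complex b (phi + psi).
Proof. by move=> Cphi Cpsi; rewrite -[phi]scale1r; exact: in_complexP. Qed.

Lemma in_complex_weaken b k (phi : C k) : in_complex true phi -> in_complex b phi.
Proof. by case=> iphi bphi phi0; split=> // _; exact: bphi. Qed.

Lemma in_complexS b k (phi : C k.+1) :
  invariant phi -> (b -> bounded phi) -> in_complex b phi.
Proof. by []. Qed.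

Lemma bounded_delta k (phi : C k) : bounded phi -> bounded (delta phi).
Proof. by move=> [M phiM]; exists (k.+1%:R * M); exact: delta_le. Qed.

Lemma boundedD k (phi psi : C k) : bounded phi -> bounded psi -> bounded (phi + psi).
Proof.
move=> [M hM] [N hN]; exists (M + N) => x.
by apply: le_trans (ler_normD _ _) _; exact: lerD.
Qed.

(** [phi] is the reason why [a] dies in unbounded cohomology; [normS] is an infimum
    over such cochains. *)
Definition primitive n (phi : C n) (a : EHb R K n) : Prop :=
  in_complex false phi /\ exists2 z : cocycle R K true n, val z = delta phi & class z = val a.

Lemma primitive_ex n (a : EHb R K n) : exists phi, primitive phi a.
Proof.
case: a => a /=; elim/quotW: a => z za.
have /class0P[phi Cphi dphi] : class (forget_bound z) = 0.
  move: (za); rewrite /in_EHb /comparison.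
  by rewrite (quot_mapE (@forget_bound_coboundary R K n)) => /eqP.
by exists phi; split=> //; exists z.
Qed.

Lemma primitive_inj n (phi : C n) a a' : primitive phi a -> primitive phi a' -> a = a'.
Proof.
move=> [_ [z zphi za]] [_ [z' z'phi z'a]]; apply: val_inj; rewrite -za -z'a.
by congr class; apply: val_inj; rewrite zphi z'phi.
Qed.

Lemma primitive_bounded_delta n (phi : C n) : in_complex false phi ->
  bounded (delta phi) -> exists a, primitive phi a.
Proof.
move=> Cphi bphi.
have zP : is_cocycle true (delta phi).
  apply/asboolP; split; last exact: delta_delta.
  by apply: in_complexS => //; apply: invariant_delta; case: Cphi.
pose z : cocycle R K true n := Sub (delta phi) zP.
have za : in_EHb (class z).
  rewrite /in_EHb /comparison /class.
  rewrite (quot_mapE (@forget_bound_coboundary R K n)); apply/eqP.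
  by apply/class0P; exists phi.
by exists (Sub (class z) za); split=> //; exists z; rewrite ?SubK.
Qed.

Lemma primitive_delta_bounded n (phi : C n) a : primitive phi a -> bounded (delta phi).
Proof. by move=> [_ [[z /asboolP[[_ + _] _]] /= <- _]]; apply. Qed.

Lemma primitive_diff n (phi psi : C n) a : primitive phi a -> primitive psi a ->
  exists2 b : C n, in_complex true b & delta b = delta psi - delta phi.
Proof.
move=> [_ [z zphi za]] [_ [z' z'psi z'a]].
have /class_eqP[b Cb db] : class z' = class z by rewrite za.
by exists b; rewrite // db zphi z'psi.
Qed.

Lemma primitive_perturb n (phi psi : C n) a (b : C n) : primitive phi a ->
  in_complex false psi -> in_complex true b -> delta b = delta psi - delta phi ->
  primitive psi a.
Proof.
move=> phia Cpsi Cb db; have [_ [z zphi za]] := phia.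
have [a' psia'] : exists a', primitive psi a'.
  apply: primitive_bounded_delta => //.
  have -> : delta psi = delta b + delta phi by rewrite db subrK.
  apply: boundedD; last exact: primitive_delta_bounded phia.
  by apply: bounded_delta; case: Cb => _ + _; apply.
have [_ [z' z'psi z'a']] := psia'.
suff <- : a' = a by [].
by apply: val_inj; rewrite -z'a' -za; apply/class_eqP; exists b; rewrite // db zphi z'psi.
Qed.

Lemma primitiveB n (phi b : C n) a : primitive phi a -> in_complex true b ->
  primitive (phi - b) a.
Proof.
move=> phia Cb.
apply: (primitive_perturb (b := 0 - b) phia).
- by apply: in_complexB; [case: phia | exact: in_complex_weaken].
- by apply: in_complexB => //; exact: in_complex0.
- by rewrite !deltaB delta0 addrAC subrr.
Qed.

Lemma primitiveD n (phi b : C n) a : primitive phi a -> in_complex true b ->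
  primitive (phi + b) a.
Proof.
move=> phia Cb; rewrite -[b]opprK; apply: primitiveB => //.
by rewrite -sub0r; apply: in_complexB => //; exact: in_complex0.
Qed.

(** The difference is, up to a cocycle, the homotopy applied to the bounded cochain
    [delta phi]. *)
Lemma primitive_alt k (phi : C k.+1) a : primitive phi a -> primitive (alt phi) a.
Proof.
move=> phia; have [Cphi _] := phia; have [iphi _ _] := Cphi.
apply: (primitive_perturb (b := 0 - alt_homotopy (delta phi)) phia).
- by apply: in_complexS => //; exact: alt_invariant.
- apply: in_complexB; [exact: in_complex0 | apply: in_complexS].
    by move=> g; rewrite -alt_homotopy_act invariant_delta.
  move=> _; have [M phiM] := primitive_delta_bounded phia.
  by have [c cP] := alt_homotopy_le R K k.+1; exists (c * M); exact: cP.
- have E : delta phi - delta (alt phi) = delta (alt_homotopy (delta phi)).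
    by rewrite -deltaB alt_homotopyP raddfD /= delta_delta add0r.
  by rewrite deltaB delta0 sub0r -E opprB.
Qed.

Lemma le_supnorm k (phi : C k) (m : R) :
  (forall x, `|phi x| <= m) <-> (supnorm phi <= m%:E)%E.
Proof.
split=> [phim|le x].
  by apply: ub_ereal_sup => _ [x _ <-]; rewrite lee_fin.
rewrite -lee_fin; apply: le_trans le; apply: ereal_sup_ubound.
by exists x.
Qed.

Lemma normS_le n (S : set K) (a : EHb R K n) phi (m : R) : primitive phi a ->
  (forall x, (forall i, S (x i)) -> phi x = 0) -> (forall x, `|delta phi x| <= m) ->
  (normS S a <= m%:E)%E.
Proof.
move=> [Cphi za] phi0 /le_supnorm; apply: le_trans.
by apply: ereal_inf_lbound; exists phi => //; split.
Qed.

Lemma normS_lt n (S : set K) (a : EHb R K n) (m : R) : (normS S a < m%:E)%E ->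
  exists phi, [/\ primitive phi a, forall x, (forall i, S (x i)) -> phi x = 0 &
    forall x, `|delta phi x| <= m].
Proof.
move=> /ereal_inf_lt[_ [phi [Cphi za phi0] <-] /ltW/le_supnorm dphi].
by exists phi.
Qed.

Lemma norm_infty0_le n (a : EHb R K n) (x : \bar R) :
  (forall S, finite_set S -> (normS S a <= x)%E) -> (norm_infty0 a <= x)%E.
Proof. by move=> le; apply: ub_ereal_sup => _ [S Sfin <-]; exact: le. Qed.

Lemma le_norm_infty0 n (a : EHb R K n) S :
  finite_set S -> (normS S a <= norm_infty0 a)%E.
Proof. by move=> Sfin; apply: ereal_sup_ubound; exists S. Qed.

Lemma norm_infty0_ge0 n (a : EHb R K n) : (0 <= norm_infty0 a)%E.
Proof.
apply: le_trans (le_norm_infty0 a (finite_set0 K)).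
apply: le_ereal_inf_tmp => _ [phi _ <-].
apply: (@le_trans _ _ (`|delta phi (fun=> 1%g)|%:E)); first by rewrite lee_fin.
by apply: ereal_sup_ubound; exists (fun=> 1%g).
Qed.

(** Only the orbits of simplices with vertices in [S] are kept: for finite [S] and
    invariant [phi] this is bounded ([trunc_complex]), while [phi - trunc S phi]
    vanishes on [S]. *)
Definition trunc k (S : set K) (phi : C k) : C k := fun x =>
  if `[< exists g, forall i, S (g * x i)%g >] then phi x else 0.

Lemma truncE k (S : set K) (phi : C k) x : (forall i, S (x i)) -> trunc S phi x = phi x.
Proof.
by move=> xS; rewrite /trunc asboolT //; exists 1%g => i; rewrite mul1g.
Qed.

Lemma trunc_complex k (S : set K) (phi : C k) b : finite_set S ->
  in_complex false phi -> in_complex b (trunc S phi).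
Proof.
move=> Sfin [iphi _ phi0]; apply: in_complex_weaken; split.
- move=> g; apply/funext => x; rewrite /act /trunc.
  have -> : (exists h, forall i, S (h * (g^-1 * x i))%g) =
      (exists h, forall i, S (h * x i)%g).
    apply/propext; split=> -[h hS].
      by exists (h * g^-1)%g => i; rewrite -mulgA.
    by exists (h * g)%g => i; rewrite -mulgA mulVKg.
  by case: ifP => // _; rewrite -[in RHS](iphi g).
- move=> _; have /finite_seqP[s sE] := Sfin.
  exists (\sum_(a : {ffun 'I_k -> 'I_(size s)}) `|phi (fun i => nth 1%g s (a i))|) => x.
  rewrite /trunc; case: asboolP => [[g gS]|_]; last by rewrite normr0 sumr_ge0.
  have /choice[a aP] : forall i, exists l : 'I_(size s), nth 1%g s l = (g * x i)%g.
    move=> i; have si : (g * x i)%g \in s by have := gS i; rewrite sE.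
    have lt : (index (g * x i)%g s < size s)%N by rewrite index_mem.
    by exists (Ordinal lt); rewrite /= nth_index.
  rewrite (bigD1 [ffun i => a i]) //= ler_wpDr ?sumr_ge0 //.
  rewrite -[in leLHS](iphi g^-1%g) /act invgK.
  suff -> : (fun i => nth 1%g s ([ffun i0 => a i0] i)) = (fun i => (g * x i)%g) by [].
  by apply/funext => i; rewrite ffunE aP.
- by move=> k0; rewrite /trunc; apply/funext => x; rewrite phi0 // if_same.
Qed.

Lemma trunc_alternating k (S : set K) (phi : C k) :
  alternating phi -> alternating (trunc S phi).
Proof.
move=> aphi s x; rewrite /trunc.
have -> : (exists g, forall i, S (g * (x \o s) i)%g) = (exists g, forall i, S (g * x i)%g).
  apply/propext; split=> -[g gS]; exists g => i; last exact: gS.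
  by rewrite -[i](permKV s); exact: gS.
by case: ifP => _; rewrite ?aphi ?mulr0.
Qed.

Lemma vanishes_smallP k (S : set K) (phi : C k.+1) : invariant phi ->
  (forall x, (forall i, S (x i)) -> phi x = 0) -> vanishes_small S phi.
Proof.
move=> iphi phi0 x xS; rewrite -(iphi (x ord0)) /act; apply: phi0 => i.
exact: xS.
Qed.

Lemma vanishes_small_trunc k (S : set K) (phi : C k.+1) :
  vanishes_small S (phi - trunc S phi).
Proof.
move=> x xS; rewrite cochainB /trunc asboolT ?subrr //.
by exists (x ord0)^-1%g => i; exact: xS.
Qed.

End Primitives.

Lemma primitive_restrict (R : realType) (G L : groupType)
    (f : UMagmaMorphism.type L G) n (phi : cochain R G n) (a : EHb R G n) :
  primitive phi a -> primitive (pullback f phi) (EHb_map R f n a).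
Proof.
move=> [Cphi [z zphi za]]; split; first exact: pullback_in_complex.
exists (pullback_cocycle f z); first by rewrite /= zphi.
rewrite /= -za /cohomology_map /class.
by rewrite (quot_mapE (@pullback_coboundary R G L f true n)).
Qed.

(** * A primitive correctable on every finite set *)

Section SelectPrimitive.
Variables (R : realType) (K : groupType).

(** For a primitive [v] of [a] this implies that [normS S a] is at most [m].  Unlike
    primitivity it makes sense for any cochain, and it is subadditive. *)
Definition correctable n (S : set K) (m : R) (v : cochain R K n) : Prop :=
  exists b, [/\ in_complex true b, forall x, (forall i, S (x i)) -> (v + b) x = 0 &
    forall x, `|delta (v + b) x| <= m].

Lemma correctable_graded n : graded_bound (@correctable n).
Proof.
split=> [S S' m m' v SS' mm' [b [Cb b0 bm]]|
         S m m' v w [b [Cb b0 bm]] [b' [Cb' b0' bm']]|S m r v [b [Cb b0 bm]]].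
- exists b; split=> // [x xS|x]; first by apply: b0 => i; apply: SS'.
  exact: le_trans (bm x) mm'.
- have E : v + w + (b + b') = (v + b) + (w + b') by rewrite addrACA.
  exists (b + b'); split; first exact: in_complexD.
    by move=> x xS; rewrite E cochainD b0 // b0' // addr0.
  move=> x; rewrite E raddfD /= cochainD; apply: le_trans (ler_normD _ _) _.
  exact: lerD.
- have E : r *: v + r *: b = r *: (v + b) by rewrite scalerDr.
  exists (r *: b); split.
  + by rewrite -[r *: b]addr0; apply: in_complexP => //; exact: in_complex0.
  + by move=> x xS; rewrite E -[LHS]/(r * (v + b) x) b0 // mulr0.
  + move=> x; rewrite E linearZ -[X in `|X|]/(r * delta (v + b) x) normrM.
    exact: ler_wpM2l.
Qed.

Lemma cocycle_correctable k (z : cochain R K k.+1) : in_complex false z ->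
  delta z = 0 -> finite_at (@correctable k.+1) z.
Proof.
move=> Cz dz S Sfin; have Ct := trunc_complex true Sfin Cz.
have [M bM] : bounded (delta (z - trunc S z)).
  rewrite deltaB dz sub0r -[- _]sub0r -delta0 -deltaB; apply: bounded_delta.
  by have [_ + _] := in_complexB (in_complex0 _ _ _ _) Ct; apply.
exists M, (0 - trunc S z); split.
- by apply: in_complexB => //; exact: in_complex0.
- by move=> x xS; rewrite sub0r cochainB truncE ?subrr.
- by move=> x; rewrite sub0r.
Qed.

(** A primitive that vanishes on [S] differs from a fixed one by a combination of
    finitely many cocycles, a bounded cochain, and a coboundary which is bounded
    after truncation to [S].  By [select_combination] the combination can be chosen
    independently of [S]; adding it to the fixed primitive gives [v]. *)
Lemma uniform_primitive k (a : EHb R K k.+2) (M : R) :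
  finite_dimensional (Hn R K k.+1) -> norm_infty0 a = M%:E ->
  exists2 v : cochain R K k.+2, primitive v a &
    forall S m, finite_set S -> M < m -> correctable S m v.
Proof.
move=> [d [e espan]] aM; have [phi phia] := primitive_ex a.
have /choice[f fP] : forall i, exists z : cocycle R K false k.+1, class z = e i.
  by move=> i; elim/quotW: (e i) => z; exists z.
pose s := [seq val (f i) | i <- enum 'I_d].
have scoc w : combination s w -> in_complex false w /\ delta w = 0.
  have : {in s, forall z, in_complex false z /\ delta z = 0}.
    by move=> _ /mapP[i _ ->]; exact: asboolW (valP (f i)).
  elim: s w => [|z l IH] w /= lP; first by move=> ->; rewrite delta0; split=> //; exact: in_complex0.
  move=> [t [w' w'l ->]]; have [Cz dz] := lP z (mem_head _ _).
  have [Cw dw] := IH w' (fun z' h => lP z' (mem_behead (s := z :: l) h)) w'l.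
  by split; [exact: in_complexP | rewrite delta_linear dz dw scaler0 addr0].
have ex S m : finite_set S -> M < m ->
    exists2 w, combination s w & correctable S m (phi + w).
  move=> Sfin Mm.
  have /normS_lt[psi [psia psi0 psim]] : (normS S a < m%:E)%E.
    by apply: le_lt_trans (le_norm_infty0 a Sfin) _; rewrite aM lte_fin.
  have [b Cb db] := primitive_diff phia psia.
  have [Cphi _] := phia; have [Cpsi _] := psia.
  have zP : is_cocycle false (psi - phi - b).
    apply/asboolP; split.
      by apply: in_complexB; [exact: in_complexB | exact: in_complex_weaken].
    by rewrite !deltaB db subrr.
  pose z : cocycle R K false k.+1 := Sub (psi - phi - b) zP.
  have [c cP] := espan (class z).
  pose zc := \sum_(i < d) c i *: f i.
  have /class_eqP[u Cu du] : class z = class zc.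
    rewrite cP; apply: (big_ind2 (fun q z => q = class z)) => [|_ y _ y' -> ->|i _].
    - by apply: (addrI (class 0)); rewrite addr0 /class -quot_piD addr0.
    - by rewrite /class quot_piD.
    - by rewrite /class quot_piZ -fP.
  have zcE : val zc = \sum_(i < d) c i *: val (f i).
    by rewrite /zc raddf_sum; apply: eq_bigr => i _.
  pose w := val zc; have ws : combination s w.
    by rewrite /w zcE -big_enum; exact: combination_sum.
  have Ct := trunc_complex true Sfin Cu.
  have psiE : psi = phi + w + (b + delta u).
    rewrite du -[val zc]/w (_ : val z = psi - phi - b) //; apply/funext => x.
    by rewrite !(cochainD, cochainN); ring.
  exists w => //; exists (b + delta (trunc S u)).
  have E : phi + w + (b + delta (trunc S u)) = psi - (delta u - delta (trunc S u)).
    by rewrite psiE; apply/funext => x; rewrite !(cochainD, cochainN); ring.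
  split.
  - apply: in_complexD => //; apply: in_complexS.
      by apply: invariant_delta; case: Ct.
    by move=> _; apply: bounded_delta; case: Ct => _ + _; apply.
  - move=> x xS; rewrite E cochainB psi0 // -deltaB sub0r /delta big1 ?oppr0 // => i _.
    by rewrite cochainB truncE ?subrr ?mulr0.
  - by move=> x; rewrite E deltaB deltaB !delta_delta subr0 subr0.
have [w ws wP] : exists2 w, combination s w &
    forall S m, finite_set S -> M < m -> correctable S m (phi + w).
  apply: (select_combination (correctable_graded _)) ex => z.
  move=> /mapP[i _ ->]; have [Cz dz] := asboolW (valP (f i)).
  exact: cocycle_correctable.
exists (phi + w) => //; have [Cw dw] := scoc w ws.
apply: (primitive_perturb (b := 0) phia).
- by apply: in_complexD => //; case: phia.
- exact: in_complex0.
- by rewrite raddfD /= dw addr0 subrr delta0.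
Qed.

(** If [s] bounds [b], so does [(s + m) / 2], by comparing the values of [b] on
    [(x0, x1)] and on the pair with the step [x0^-1 * x1] doubled. *)
Lemma bounded_one_cochain (b : cochain R K 2) m : in_complex true b ->
  (forall x, `|delta b x| <= m) -> forall x, `|b x| <= m.
Proof.
move=> [ib bb _] dbm; have [B bB] := bb isT.
pose A := [set `|b x| | x in [set: 'I_2 -> K]].
have Asup : has_sup A.
  split; first by exists `|b (fun=> 1%g)|, (fun=> 1%g).
  by exists B => _ [x _ <-]; exact: bB.
have half x : 2 * `|b x| <= m + sup A.
  pose g := (x ord0 * (x ord_max)^-1)%g.
  pose y (i : 'I_3) := nth 1%g [:: x ord0; x ord_max; g^-1 * x ord_max]%g i.
  pose x' (i : 'I_2) := y (lift (lift ord0 ord0) i).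
  have E : b x + b x = delta b y + b x'.
    rewrite /delta !big_ord_recl big_ord0 /= !exprS expr0.
    have -> : (fun j => y (lift ord0 j)) = fun i => (g^-1 * x i)%g.
      apply/funext => i; case: (unliftP ord0 i) => [j|] ->; rewrite /y /=; last first.
        by rewrite invgM invgK mulgVK.
      by rewrite ord1; congr (_ * x _)%g; apply: ord_inj.
    have -> : (fun j => y (lift (lift ord0 (lift ord0 ord0)) j)) = x.
      apply/funext => i; case: (unliftP ord0 i) => [j|] ->; rewrite /y //=.
      by rewrite ord1 /=; congr x; apply: ord_inj.
    by rewrite -/x' -[b (fun i => (g^-1 * x i)%g)]/(act g b x) ib; ring.
  have xA : `|b x'| <= sup A by apply: (ub_le_sup Asup.2); exists x'.
  have -> : 2 * `|b x| = `|b x + b x| :> R.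
    have -> : b x + b x = 2 * b x :> R by ring.
    by rewrite normrM normr_nat.
  by rewrite E; apply: le_trans (ler_normD _ _) _; exact: lerD.
have supm : sup A <= m.
  have : sup A <= (m + sup A) / 2.
    apply: ge_sup Asup.1 _ => _ [x _ <-].
    by rewrite ler_pdivlMr // mulrC.
  by lra.
by move=> x; apply: le_trans supm; apply: (ub_le_sup Asup.2); exists x.
Qed.

End SelectPrimitive.

Lemma primitive0 (R : realType) (K : groupType) n : primitive (0 : cochain R K n) (0 : EHb R K n).
Proof.
split; first exact: in_complex0.
exists 0; first by rewrite delta0.
by apply: (addrI (class 0)); rewrite addr0 /class -quot_piD addr0.
Qed.

Lemma norm_infty0_0 (R : realType) (K : groupType) n :
  (norm_infty0 (0%R : EHb R K n) <= 0)%E.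
Proof.
apply: norm_infty0_le => S _; apply: normS_le (primitive0 R K n) _ _ => // x.
by rewrite delta0 normr0.
Qed.

(** * Lifting classes *)

Section Transfer.
Variables (R : realType) (G : groupType) (P : groupClosed G)
  (H : subGroupType (P : {pred G})).
Variables (S0 : set H) (E : forall k, cochain R H k.+1 -> cochain R G k.+1).
Hypothesis Eop : @extension_operator R G P H S0 E.
Local Notation res n := (EHb_map R (\val : H -> G) n).

Definition admissible k (phi : cochain R H k.+1) :=
  [/\ invariant phi, alternating phi & vanishes_small S0 phi].

Lemma admissible_delta k (phi : cochain R H k.+1) : admissible phi -> admissible (delta phi).
Proof.
by move=> [iphi aphi phi0]; split;
  [exact: invariant_delta | exact: alternating_delta | exact: vanishes_small_delta].
Qed.

Lemma extend_delta_le k (phi : cochain R H k.+2) (m : R) : admissible phi ->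
  (forall x, `|delta phi x| <= m) ->
  forall x, `|delta (E phi) x| <= (k.+3 ^ 3)%:R * m.
Proof.
move=> adm phim; have [iphi aphi phi0] := adm.
have [idphi adphi dphi0] := admissible_delta adm.
rewrite (ext_commutes Eop) //; apply: (ext_bounded Eop) => //.
exact: le_trans (normr_ge0 _) (phim (fun=> 1%g)).
Qed.

Lemma extend_primitive k (phi : cochain R H k.+2) (b : EHb R H k.+2) :
  admissible phi -> primitive phi b ->
  exists2 a : EHb R G k.+2, primitive (E phi) a & res k.+2 a = b.
Proof.
move=> adm phib; have [iphi aphi phi0] := adm.
have [m phim] := primitive_delta_bounded phib.
have CE : in_complex false (E phi) by apply: in_complexS => //; exact: (ext_invariant Eop).
have [|a Ea] := primitive_bounded_delta CE.
  by exists ((k.+3 ^ 3)%:R * m); exact: extend_delta_le.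
exists a => //; apply: primitive_inj phib.
have := primitive_restrict (\val : H -> G) Ea.
suff -> : pullback (\val : H -> G) (E phi) = phi by [].
by apply/funext => x; rewrite /pullback -[RHS](ext_restrict Eop).
Qed.

Lemma admissible_primitive k (b : EHb R H k.+2) :
  exists2 phi, admissible phi & primitive phi b.
Proof.
have [phi phib] := primitive_ex b.
have aphib := primitive_alt phib; have [Caphi _] := aphib; have [iaphi _ _] := Caphi.
have Ct := trunc_complex true (ext_fin Eop) Caphi.
exists (alt phi - trunc S0 (alt phi)); last exact: primitiveB.
split; last exact: vanishes_small_trunc.
  by case: (in_complexB Caphi (in_complex_weaken false Ct)).
move=> s x; rewrite !cochainB (trunc_alternating S0 (alternating_alt phi)).
by rewrite alternating_alt mulrBr.
Qed.

Lemma res_surjective k (b : EHb R H k.+2) : exists a, res k.+2 a = b.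
Proof.
by have [phi adm phib] := admissible_primitive b; have [a _ ab] := extend_primitive adm phib; exists a.
Qed.

(** Alternation keeps all the properties of a corrected primitive, and makes it a
    cochain to which the extension applies. *)
Lemma correctable_admissible k (S : set H) m (v : cochain R H k.+2) (b : EHb R H k.+2) :
  S0 `<=` S -> primitive v b -> correctable S m v ->
  exists2 c, in_complex true c & [/\ admissible (alt (v + c)), primitive (alt (v + c)) b,
    forall x, (forall i, S (x i)) -> alt (v + c) x = 0 &
    forall x, `|delta (alt (v + c)) x| <= m].
Proof.
move=> S0S vb [c [Cc c0 cm]]; exists c => //.
have vcb : primitive (v + c) b by exact: primitiveD.
have ivc : invariant (v + c) by case: vcb => -[].
have zero : forall x, (forall i, S (x i)) -> alt (v + c) x = 0 by exact: alt_eq0.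
split=> //.
- split; [exact: alt_invariant | exact: alternating_alt |].
  apply: vanishes_smallP; first exact: alt_invariant.
  by move=> x xS; apply: zero => i; apply: S0S.
- exact: primitive_alt.
- by rewrite delta_alt; exact: alt_le.
Qed.

(** The class [a] is the extension of the uniform primitive [v] corrected on [S0].
    For a finite set [S'] of the ambient group, [v] is corrected on a larger set,
    such that the extension vanishes on [S']; this does not change the class, as
    the difference of the corrections has a bounded extension. *)
Lemma lift_norm k (b : EHb R H k.+2) (M : R) : finite_dimensional (Hn R H k.+1) ->
  norm_infty0 b = M%:E ->
  exists2 a, res k.+2 a = b & (norm_infty0 a <= (k.+3 ^ 3)%:R%:E * norm_infty0 b)%E.
Proof.
move=> fd bM; have [v vb vS] := uniform_primitive fd bM.
have M1 : M < M + 1 by lra.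
case: k b fd bM v vb vS => [|k] b fd bM v vb vS.
  (* At each simplex [v] is cancelled by some correction, and two corrections differ
     by a bounded one-cochain with differential bounded by [2 * (M + 1)].  So
     [v + c0] is bounded, and [b] is zero. *)
  suff -> : b = 0.
    exists 0; first exact: linear0.
    apply: le_trans (norm_infty0_0 _ _ _) _.
    by rewrite mule_ge0 ?norm_infty0_ge0 // lee_fin.
  have [c0 [Cc0 _ c0m]] := vS set0 _ (finite_set0 H) M1.
  have bounded_v : bounded (v + c0).
    exists ((M + 1) + (M + 1)) => x.
    have [c [Cc cv cm]] := vS [set` codom x] _ (finite_seq _) M1.
    have -> : (v + c0) x = (c0 - c) x.
      have := cv x (fun i => codom_f x i); rewrite cochainB !cochainD => vc.
      by lra.
    apply: bounded_one_cochain; first exact: in_complexB.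
    move=> y; have -> : c0 - c = (v + c0) - (v + c).
      by apply/funext => z; rewrite !(cochainD, cochainN); ring.
    by rewrite deltaB cochainB; apply: le_trans (ler_normB _ _) _; exact: lerD.
  have vc0b := primitiveD vb Cc0.
  have : primitive (v + c0 - (v + c0)) b.
    apply: primitiveB => //; apply: in_complexS => //.
    by case: vc0b => -[].
  by rewrite subrr => /primitive_inj; apply; exact: primitive0.
have [c0 Cc0 [adm0 prim0 _ _]] :=
  correctable_admissible (@subset_refl _ S0) vb (vS _ _ (ext_fin Eop) M1).
have [a Ea ab] := extend_primitive adm0 prim0; exists a => //.
rewrite bM -EFinM; apply: norm_infty0_le => S' S'fin.
have /finite_seqP[X XE] := S'fin.
have [S [Sfin SP]] := ext_support Eop X.
apply/lee_addgt0Pr => e e0; rewrite -EFinD.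
set C : R := (k.+4 ^ 3)%:R; have C0 : 0 < C by rewrite ltr0n expn_gt0.
have Me : M < M + e / C by rewrite ltrDl divr_gt0.
have fin : finite_set (S0 `|` S) by rewrite finite_setU; split=> //; exact: ext_fin Eop.
have [c Cc [adm prim zero dm]] :=
  correctable_admissible (@subsetUl _ S0 S) vb (vS _ _ fin Me).
have [iphi aphi phi0] := adm; have [iphi0 aphi0 phi00] := adm0.
have -> : C * M + e = C * (M + e / C) by rewrite mulrDr mulrCA divff ?mulr1 ?gt_eqF.
apply: (@normS_le _ _ _ S' a (E (alt (v + c)))).
- pose D := alt (v + c) - alt (v + c0).
  have DE : D = alt (c - c0).
    rewrite /D -altB; congr alt; apply/funext => z.
    by rewrite !(cochainD, cochainN); ring.
  have CD : in_complex true (c - c0) by exact: in_complexB.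
  have [iD bD _] := CD; have [m Dm] := bD isT.
  apply: (primitive_perturb (b := E D) Ea).
  + by apply: in_complexS => //; exact: (ext_invariant Eop).
  + apply: in_complexS; first exact: (ext_invariant Eop).
    move=> _; exists ((k.+3 ^ 3)%:R * m); apply: (ext_bounded Eop).
    * by rewrite DE; exact: alt_invariant.
    * by rewrite DE; exact: alternating_alt.
    * by move=> x xs; rewrite /D cochainB phi0 ?phi00 ?subrr.
    * exact: le_trans (normr_ge0 _) (Dm (fun=> 1%g)).
    * by rewrite DE; exact: alt_le.
  + by rewrite /D (ext_sub Eop) // deltaB.
- move=> x xS'; apply: SP => // [y yS|i]; first by apply: zero => i; right.
  by have := xS' i; rewrite XE.
- exact: extend_delta_le.
Qed.

End Transfer.

(** If the norm of a class is infinite, any lift will do, because the constant is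
    positive. *)
Lemma EHb_map_undistorted (R : realType) (G : groupType) (P : groupClosed G)
    (H : subGroupType (P : {pred G})) (k : nat) :
  hyperbolically_embedded P -> finite_dimensional (Hn R H k.+1) ->
  let res := EHb_map R (\val : H -> G) k.+2 in
  (forall b, exists a, res a = b) /\ undistorted norm_infty0 norm_infty0 res.
Proof.
move=> hyp fd res; have [S0 [E Eop]] := extension_operator_ex R H hyp.
have surj b : exists a, res a = b by exact: (res_surjective Eop).
split=> //; exists (k.+3 ^ 3)%:R; first exact: ler0n.
move=> b _; have := norm_infty0_ge0 b.
case bM : (norm_infty0 b) => [M| |] // _.
  by rewrite -bM; exact: (lift_norm Eop fd bM).
have [a ab] := surj b; exists a => //.
by rewrite gt0_muley ?leey // lte_fin ltr0n expn_gt0.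
Qed.

Lemma subgroup_closed (G : groupType) (P : {pred G}) (H : subGroupType P) :
  [/\ 1%g \in P, {in P &, forall x y, (x * y)%g \in P} & {in P, forall x, x^-1%g \in P}].
Proof.
have lift x : x \in P -> exists h : H, val h = x.
  by move=> Px; exists (Sub x Px); rewrite SubK.
split.
- have <- : val (1%g : H) = 1%g :> G by exact: gmulf1.
  exact: valP.
- move=> x y /lift[h <-] /lift[h' <-].
  have <- : val (h * h')%g = (val h * val h')%g :> G by exact: gmulfM.
  exact: valP.
- move=> x /lift[h <-].
  have <- : val h^-1%g = (val h)^-1%g :> G by exact: gmulfV.
  exact: valP.
Qed.

Theorem theorem4 (R : realType) (Gamma : groupType) (P : {pred Gamma})
    (H : subGroupType P) (n : nat) :
  hyperbolically_embedded P ->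
  (2 <= n)%N ->
  finite_dimensional (Hn R H n.-1) ->
  let res : EHb R Gamma n -> EHb R H n := EHb_map R (\val : H -> Gamma) n in
  (forall b, exists a, res a = b) /\
  undistorted norm_infty0 norm_infty0 res.
Proof.
have [P1 PM PV] := subgroup_closed H.
pose P' : groupClosed Gamma := HB.pack P (isMulClosed.Build Gamma P PM)
  (isMul1Closed.Build Gamma P P1) (isInvClosed.Build Gamma P PV).
case: n => [|[|k]] // hyp _ fd.
exact: (@EHb_map_undistorted R Gamma P' H k hyp fd).
Qed.
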